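(* Let $n\ge3$ and $k\ge1$. (i) $H_{n,k,\mathrm{sol}}=H_{n,k,1}\oplus H_{n,k,2}$, where $H_{n,k,1}:=\{w\in H_{n,k,\mathrm{sol}}:A(w)=-k\,w\}$ is the eigenspace of $A$ for the eigenvalue $-k$ and $H_{n,k,2}:=\{w\in H_{n,k,\mathrm{sol}}:A(w)=w\}$ the eigenspace for the eigenvalue $1$. (ii) The subspace $H_{n,k,3}:=H_{n,k,\mathrm{sol}}^\perp$ is an eigenspace of $A$ with eigenvalue $k+n-2$, i.e. $A(w)=(k+n-2)w$ for all $w\in H_{n,k,\mathrm{sol}}^\perp$.
   Context: $\mathbb S^{n-1}\subset\mathbb R^n$ unit sphere, $B_1$ unit ball; $\mathrm{Av}(f):=\frac{1}{\mathcal H^{n-1}(\mathbb S^{n-1})}\int_{\mathbb S^{n-1}}f\,d\mathcal H^{n-1}$. $\{\tau_i\}$ local orthonormal tangent frame; $\nabla_T w^j$ is the tangential gradient vector of the $j$-th component of $w$, $\mathrm{div}_{\mathbb S^{n-1}}w:=\sum_i\langle\partial_{\tau_i}w,\tau_i\rangle$; $w_h$ is the componentwise harmonic extension of $w$ to $\overline{B_1}$. $H_n:=\{w\in W^{1,2}(\mathbb S^{n-1};\mathbb R^n):\mathrm{Av}(w)=0,\ \mathrm{Av}(\langle w,x\rangle)=0\}$; $A(w):=(\mathrm{div}_{\mathbb S^{n-1}}w)x-\sum_{j=1}^n x_j\nabla_T w^j$. $H_{n,k}$ is the subspace of $H_n$ of maps whose components are all $k$-th order spherical harmonics (restrictions of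 homogeneous harmonic polynomials of degree $k$); $H_{n,k,\mathrm{sol}}:=\{w\in H_{n,k}:\mathrm{div}\,w_h\equiv0\text{ in }B_1\}$ and $H_{n,k,\mathrm{sol}}^\perp$ is its $W^{1,2}$-orthogonal complement in $H_{n,k}$. *)

(* Defs.v *)
From mathcomp Require Import all_boot all_order all_algebra.
From mathcomp Require Import all_classical all_reals all_analysis.
From mathcomp Require mpoly.
Import -(notations) mpoly.

Set Implicit Arguments.
Unset Strict Implicit.
Unset Printing Implicit Defensive.

Import Order.TTheory GRing.Theory Num.Theory.
Local Open Scope ring_scope.

Section Defs.
Variable R : realType.

Definition dotp (n : nat) (x y : 'I_n -> R) : R := \sum_(i < n) x i * y i.

Definition on_sphere (n : nat) (x : 'I_n -> R) : Prop := dotp x x = 1.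

(* iint m f = \int_{R^m} f, integrating the coordinates 0,...,m-1 of
   f : (nat -> R) -> R one after the other w.r.t. Lebesgue measure on R. *)
Fixpoint iint (m : nat) (f : (nat -> R) -> R) : R :=
  match m with
  | 0 => f (fun _ => 0)
  | m'.+1 => Rintegral (@lebesgue_measure R) setT
      (fun t : R => iint m' (fun y => f (fun i => if i is j.+1 then y j else t)))
  end.

(* Integral over S^{n-1} w.r.t. H^{n-1}, via the cone formula
   \int_{S^{n-1}} f dH^{n-1} = n \int_{B_1} f(x/|x|) dx. *)
Definition sphint (n : nat) (f : ('I_n -> R) -> R) : R :=
  n%:R * iint n (fun y =>
    let x : 'I_n -> R := fun i => y (val i) in
    if dotp x x <= 1 then f (fun i => x i / Num.sqrt (dotp x x)) else 0).

Definition Av (n : nat) (f : ('I_n -> R) -> R) : R :=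
  sphint f / sphint (fun _ : 'I_n -> R => 1).

(* A map w : S^{n-1} -> R^n whose components are restrictions of polynomials
   is represented by its n polynomial components. *)
Definition polymap (n : nat) := 'I_n -> mpoly.mpoly n R.

Definition evalw (n : nat) (w : polymap n) (x : 'I_n -> R) : 'I_n -> R :=
  fun j => mpoly.meval x (w j).

Definition pgrad (n : nat) (p : mpoly.mpoly n R) (x : 'I_n -> R) : 'I_n -> R :=
  fun i => mpoly.meval x (mpoly.mderiv i p).

(* tangential gradient on the sphere at x: projection of the gradient of
   (any) extension onto the tangent space T_x S^{n-1} = x^perp *)
Definition gradT (n : nat) (p : mpoly.mpoly n R) (x : 'I_n -> R) : 'I_n -> R :=
  fun i => pgrad p x i - dotp (pgrad p x) x * x i.

(* div_{S^{n-1}} w = sum_i <d_{tau_i} w, tau_i> = sum_j <nabla_T w^j, e_j> *)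
Definition divS (n : nat) (w : polymap n) (x : 'I_n -> R) : R :=
  \sum_(j < n) gradT (w j) x j.

Definition Aop (n : nat) (w : polymap n) (x : 'I_n -> R) : 'I_n -> R :=
  fun i => divS w x * x i - \sum_(j < n) x j * gradT (w j) x i.

Definition plap (n : nat) (p : mpoly.mpoly n R) : mpoly.mpoly n R :=
  \sum_(i < n) mpoly.mderiv i (mpoly.mderiv i p).

Definition harmonic_poly (n : nat) (p : mpoly.mpoly n R) : Prop := plap p = 0.

Definition hharm (n k : nat) (p : mpoly.mpoly n R) : Prop :=
  p \is @mpoly.ishomog1 n R k mpoly.mdeg /\ harmonic_poly p.

Definition in_Hn (n : nat) (w : polymap n) : Prop :=
  (forall j : 'I_n, Av (fun x => evalw w x j) = 0) /\
  Av (fun x => dotp (evalw w x) x) = 0.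

Definition in_Hnk (n k : nat) (w : polymap n) : Prop :=
  (forall j : 'I_n, hharm k (w j)) /\ in_Hn w.

(* divergence of the (componentwise) harmonic extension w_h; for components
   that are homogeneous harmonic polynomials, w_h is the polynomial map itself *)
Definition pdiv (n : nat) (w : polymap n) : mpoly.mpoly n R :=
  \sum_(i < n) mpoly.mderiv i (w i).

Definition in_ball (n : nat) (x : 'I_n -> R) : Prop := dotp x x <= 1.

Definition in_Hsol (n k : nat) (w : polymap n) : Prop :=
  in_Hnk k w /\ forall x : 'I_n -> R, in_ball x -> mpoly.meval x (pdiv w) = 0.

Definition w12 (n : nat) (v w : polymap n) : R :=
  sphint (fun x => dotp (evalw v x) (evalw w x)) +
  sphint (fun x => \sum_(j < n) dotp (gradT (v j) x) (gradT (w j) x)).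

Definition in_Hsol_perp (n k : nat) (v : polymap n) : Prop :=
  in_Hnk k v /\ forall w : polymap n, in_Hsol k w -> w12 v w = 0.

Definition A_eig (n : nat) (lam : R) (w : polymap n) : Prop :=
  forall x : 'I_n -> R, on_sphere x -> forall i : 'I_n, Aop w x i = lam * evalw w x i.

Definition in_H1 (n k : nat) (w : polymap n) : Prop := in_Hsol k w /\ A_eig (- k%:R) w.
Definition in_H2 (n k : nat) (w : polymap n) : Prop := in_Hsol k w /\ A_eig 1 w.

End Defs.

(* Main.v *)
(* On the sphere [A w = (div w) x - grad <w, x> + w] when the components of [w] are
   homogeneous.  If [div w = 0], then [f := <w, x>] is harmonic and homogeneous of
   degree [k + 1], so [<grad f, x> = (k + 1) f] by Euler, and [w] splits as
   [grad f / (k + 1)] (eigenvalue [- k]) plus a field orthogonal to [x] (eigenvalue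
   [1]).  For general [w] with [g := div w], the field [v := x g - c |x|^2 grad g] with
   [c = 1 / (n + 2 k - 4)] is harmonic, is an eigenvector for [k + n - 2], and has
   divergence [a g] with [a <> 0]; so [u := w - v / a] is solenoidal, [v] is
   orthogonal to [u], and [w] orthogonal to [u] forces [u = 0].

   All integral identities follow from one integration by parts on the sphere,
   [\int_S d_i F = (m + n - 1) \int_S x_i F] for [F] homogeneous of degree [m].
   It comes from [\int_B d_i (F (1 - |x|^2)) = 0], a one-dimensional integration in
   the coordinate [i], and from the radial formula relating integrals over the ball
   to the cone formula defining [sphint]. *)
Require Import Defs.
From mathcomp Require Import all_boot all_order all_algebra.
From mathcomp Require Import all_classical all_reals all_analysis.
From mathcomp Require mpoly.
Import -(notations) mpoly.
Import Order.TTheory GRing.Theory Num.Theory.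
Import numFieldNormedType.Exports.
From mathcomp Require Import measurable_realfun ring lra.
Set Implicit Arguments.
Unset Strict Implicit.
Unset Printing Implicit Defensive.
Local Open Scope ring_scope.

(** * Iterated Lebesgue integrals *)

Section IteratedIntegral.
Local Open Scope classical_set_scope.
Variable R : realType.
Notation mu := (@lebesgue_measure R).
Notation intR f := (Rintegral mu setT f).

(** The interval [[-1, 1]] has finite measure. Boundedness and support in it persist under iterated
    integration, so this one criterion supplies integrability for all the integrals over the
    ball. *)
Lemma bounded_box_integrable (g : measurableTypeR R -> R) (M : R) :
  measurable_fun setT g -> (forall t, `|g t| <= M) ->
  (forall t : R, 1 < `|t| -> g t = 0) -> mu.-integrable setT (EFin \o g).
Proof.
move=> mg gM g0.
have -> : EFin \o g = (EFin \o g) \_ (`[-1, 1]%classic : set (measurableTypeR R)).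
  apply/funext => t; rewrite patchE /=; case: ifPn => //.
  rewrite notin_setE /= in_itv /= => /negP; rewrite -ler_norml -ltNge => /g0 ->.
  by [].
have mJ : measurable (`[-1, 1]%classic : set (measurableTypeR R)) by exact: measurable_itv.
apply: (iffLR (integrable_mkcond _ mJ)).
refine (@measurable_bounded_integrable _ (measurableTypeR R) R mu g _
  (measurable_itv _) _ _ _) => //=.
- by rewrite lebesgue_measure_itv/= lte_fin; case: ifP => _; rewrite ?ltry//.
- exact: measurable_funTS.
- exists M; split; first by rewrite num_real.
  by move=> x Mx t _; apply: le_trans (gM t) (ltW Mx).
Qed.

Lemma bounded_box_integral_le (g : measurableTypeR R -> R) (M : R) :
  measurable_fun setT g -> (forall t, `|g t| <= M) ->
  (forall t : R, 1 < `|t| -> g t = 0) -> `|intR g| <= M * 2.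
Proof.
move=> mg gM g0.
have ig := bounded_box_integrable mg gM g0.
pose J : set (measurableTypeR R) := `[-1, 1]%classic.
have mJ : measurable J by exact: measurable_itv.
have M0 : 0 <= M by apply: le_trans (gM 0); rewrite normr_ge0.
have h1 : forall t, `|cst M t * \1_J t| <= M.
  move=> t /=; rewrite normrM ger0_norm// ler_piMr// indicE.
  by case: (_ \in _); rewrite ?normr1 ?normr0.
apply: le_trans (le_normr_Rintegral _ ig) _ => //.
have -> : M * 2 = intR (fun t => M * \1_J t).
  rewrite RintegralZl//; last first.
    apply: (@bounded_box_integrable _ 1) => //.
    - by move=> t; rewrite indicE; case: (_ \in _); rewrite ?normr1 ?normr0.
    - move=> t t1; rewrite indicE memNset// /J /= in_itv /=.
      by apply/negP; rewrite -ler_norml -ltNge.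
  congr (_ * _); rewrite /Rintegral integral_indic// setIT.
  transitivity (fine (2%:E : \bar R)) => //; congr fine; apply/esym.
  apply: etrans (lebesgue_measure_itv `[-1, 1]%R) _ => /=.
  by rewrite lte_fin ifT; [rewrite /= -EFinD; congr EFin|]; lra.
apply: le_Rintegral => //.
- apply: (@bounded_box_integrable _ M) => //.
  + exact: measurableT_comp.
  + by move=> t; rewrite normr_id.
  + by move=> t /g0 ->; rewrite normr0.
- apply: (@bounded_box_integrable _ M) => //.
  + by apply: measurable_funM => //; exact: measurable_indic.
  + move=> t t1; rewrite indicE memNset ?mulr0// /J /= in_itv /=.
    by apply/negP; rewrite -ler_norml -ltNge.
- move=> t _; rewrite indicE; case: (boolP (t \in J)) => [_|]; first by rewrite mulr1.
  rewrite notin_setE /J /= in_itv /= => /negP; rewrite -ler_norml -ltNge => /g0 ->.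
  by rewrite normr0 mulr0.
Qed.

(** Spelled like the argument inside [iint], so that [iintS] holds by conversion. *)
Definition scons (t : R) (y : nat -> R) : nat -> R :=
  fun i => if i is j.+1 then y j else t.

Lemma iintS m f : iint m.+1 f = intR (fun t => iint m (fun y => f (scons t y))).
Proof. by []. Qed.

Lemma eq_iint m f g : f =1 g -> iint m f = iint m g :> R.
Proof. by move=> /funext ->. Qed.

Lemma iint0 m : iint m (fun=> 0) = 0 :> R.
Proof. by elim: m => // m IH; rewrite iintS IH Rintegral_cst// mul0r. Qed.

(* Measurability is required of all composites, so that coordinates can be
   integrated one at a time without a measurable structure on [nat -> R]. *)
Definition nice (m : nat) d (X : measurableType d) (F : X -> (nat -> R) -> R) :=
  [/\ forall d' (Z : measurableType d') (a : Z -> X) (y : Z -> nat -> R),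
        measurable_fun setT a ->
        (forall i, measurable_fun setT (fun z => y z i)) ->
        measurable_fun setT (fun z => F (a z) (y z)),
      exists M, forall x y, `|F x y| <= M &
      forall x y i, (i < m)%N -> 1 < `|y i| -> F x y = 0].

(** The outermost coordinate joins the parameter space. Inductions on the number of coordinates
    therefore quantify over all parameter spaces. *)
Lemma nice_scons m d (X : measurableType d) (F : X -> (nat -> R) -> R) :
  nice m.+1 F -> nice m (fun (p : X * measurableTypeR R) y => F p.1 (scons p.2 y)).
Proof.
move=> [mF [M FM] F0]; split.
- move=> d' Z a y ma my; apply: mF; first exact: measurableT_comp.
  by case=> [|i] /=; [exact: measurableT_comp|exact: my].
- by exists M => x y; exact: FM.
- by move=> x y i im yi; apply: (F0 _ _ i.+1).
Qed.

Lemma nice_fix m d (X : measurableType d) (F : X -> (nat -> R) -> R) d'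
  (X' : measurableType d') (h : X' -> X) : measurable_fun setT h -> nice m F ->
  nice m (fun x => F (h x)).
Proof.
move=> mh [mF [M FM] F0]; split.
- by move=> d'' Z a y ma my; apply: mF => //; exact: measurableT_comp.
- by exists M => x y; exact: FM.
- by move=> x y i im yi; apply: (F0 _ _ i).
Qed.

Lemma nice_iint m d (X : measurableType d) (F : X -> (nat -> R) -> R) :
  nice m F -> measurable_fun setT (fun x => iint m (F x)) /\
  exists M, forall x, `|iint m (F x)| <= M.
Proof.
elim: m d X F => [|m IH] d X F nF.
  case: nF => mF [M FM] _; split; last by exists M => x; exact: FM.
  by apply: (mF _ _ id (fun _ _ => 0)).
have nF' := nice_scons nF.
have [mG [M GM]] := IH _ _ _ nF'.
pose G (p : X * measurableTypeR R) := iint m (fun y => F p.1 (scons p.2 y)).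
have G0 x (t : R) : 1 < `|t| -> G (x, t) = 0.
  move=> t1; rewrite /G /= (@eq_iint _ _ (fun=> 0)) ?iint0// => y.
  by case: nF => _ _ F0; apply: (F0 _ _ 0%N).
have mGx x : measurable_fun setT (fun t => G (x, t)).
  by apply: (measurableT_comp mG); exact: pair1_measurable.
have iG x : mu.-integrable setT (fun t => (G (x, t))%:E).
  exact: (@bounded_box_integrable (fun t => G (x, t)) M (mGx x) (fun t => GM (x, t)) (G0 x)).
split; last first.
  exists (M * 2) => x; rewrite iintS.
  exact: (@bounded_box_integral_le (fun t => G (x, t)) M (mGx x) (fun t => GM (x, t)) (G0 x)).
(* Tonelli gives measurability in the parameter for nonnegative integrands only, hence the split
   into positive and negative parts. *)
rewrite (_ : (fun _ => _) = (fun x =>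
   fine (\int[mu]_t ((EFin \o G)^\+ (x, t)) - \int[mu]_t ((EFin \o G)^\- (x, t)))%E)); last first.
  apply/funext => x; rewrite iintS /Rintegral; congr fine; rewrite [LHS]integralE.
  by congr (_ - _)%E; apply: eq_integral => t _; rewrite ?funeposE ?funenegE.
apply: measurableT_comp => //.
apply: emeasurable_funB.
- have mGE : measurable_fun setT ((EFin \o G)^\+)%E.
    by apply: measurable_funepos; exact/measurable_EFinP.
  exact: (measurable_fun_fubini_tonelli_F _ mGE (fun x => funepos_ge0 _ x)).
- have mGE : measurable_fun setT ((EFin \o G)^\-)%E.
    by apply: measurable_funeneg; exact/measurable_EFinP.
  exact: (measurable_fun_fubini_tonelli_F _ mGE (fun x => funeneg_ge0 _ x)).
Qed.

Lemma nice_scons_integrable m d (X : measurableType d) (F : X -> (nat -> R) -> R) x :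
  nice m.+1 F ->
  mu.-integrable setT (fun t => (iint m (fun y => F x (scons t y)))%:E).
Proof.
move=> nF; have [mG [M GM]] := nice_iint (nice_scons nF).
pose G (p : X * measurableTypeR R) := iint m (fun y => F p.1 (scons p.2 y)).
apply: (@bounded_box_integrable (fun t => G (x, t)) M).
- by apply: (measurableT_comp mG); exact: pair1_measurable.
- by move=> t; exact: (GM (x, t)).
- move=> t t1; rewrite /G (@eq_iint _ _ (fun=> 0)) ?iint0// => y.
  by case: nF => _ _ F0; apply: (F0 _ _ 0%N).
Qed.

Lemma niceM m d (X : measurableType d) (c : X -> R) (F : X -> (nat -> R) -> R) :
  measurable_fun setT c -> (exists N, forall x, `|c x| <= N) ->
  nice m F -> nice m (fun x y => c x * F x y).
Proof.
move=> mc [N cN] [mF [M FM] F0]; split.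
- move=> d' Z a y ma my; apply: measurable_funM; last exact: mF.
  exact: measurableT_comp.
- by exists (N * M) => x y; rewrite normrM ler_pM.
- by move=> x y i im yi; rewrite (F0 _ _ i)// mulr0.
Qed.

Lemma iintD m d (X : measurableType d) (F G : X -> (nat -> R) -> R) x :
  nice m F -> nice m G ->
  iint m (fun y => F x y + G x y) = iint m (F x) + iint m (G x).
Proof.
elim: m d X F G x => [//|m IH] d X F G x nF nG; rewrite !iintS.
rewrite -RintegralD//; [|exact: nice_scons_integrable..].
apply: eq_Rintegral => t _.
exact: (IH _ _ _ _ (x, t : measurableTypeR R) (nice_scons nF) (nice_scons nG)).
Qed.

Lemma iintZ m d (X : measurableType d) (F : X -> (nat -> R) -> R) x (c : R) :
  nice m F -> iint m (fun y => c * F x y) = c * iint m (F x).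
Proof.
elim: m d X F x => [//|m IH] d X F x nF; rewrite !iintS.
rewrite -RintegralZl//; last exact: nice_scons_integrable.
apply: eq_Rintegral => t _.
exact: (IH _ _ _ (x, t : measurableTypeR R) (nice_scons nF)).
Qed.

Lemma le_iint m d (X : measurableType d) (F G : X -> (nat -> R) -> R) x :
  nice m F -> nice m G -> (forall y, F x y <= G x y) -> iint m (F x) <= iint m (G x).
Proof.
elim: m d X F G x => [|m IH] d X F G x nF nG FG; first exact: FG.
rewrite !iintS.
apply: le_Rintegral => //; [exact: nice_scons_integrable..|].
move=> t _.
by apply: (IH _ _ _ _ (x, t : measurableTypeR R) (nice_scons nF) (nice_scons nG)) => y; exact: FG.
Qed.

(** Fubini applies because a bounded function supported in the square [[-1, 1]^2] is integrable for
    the product measure. *)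
Lemma Rintegral_swap (g : measurableTypeR R * measurableTypeR R -> R) (M : R) :
  measurable_fun setT g -> (forall z, `|g z| <= M) ->
  (forall r t : R, 1 < `|r| -> g (r, t) = 0) ->
  (forall r t : R, 1 < `|t| -> g (r, t) = 0) ->
  intR (fun r => intR (fun t => g (r, t))) = intR (fun t => intR (fun r => g (r, t))).
Proof.
move=> mg gM g1 g2.
have mg1 r : measurable_fun setT (fun t => g (r, t)).
  by apply: (measurableT_comp mg); exact: pair1_measurable.
have mg2 t : measurable_fun setT (fun r => g (r, t)).
  by apply: (measurableT_comp mg); exact: pair2_measurable.
have i1 r := @bounded_box_integrable (fun t => g (r, t)) M (mg1 r) (fun t => gM (r, t)) (g2 r).
have i2 t := @bounded_box_integrable (fun r => g (r, t)) M (mg2 t) (fun r => gM (r, t)) (g1 ^~ t).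
pose J : set (measurableTypeR R) := `[-1, 1]%classic.
have mJ : measurable J by exact: measurable_itv.
have mJJ : measurable (J `*` J) by exact: measurableX.
have muJ : (mu J < +oo)%E.
  apply: le_lt_trans (ltry 2).
  by rewrite (lebesgue_measure_itv `[-1, 1]%R) /= lte_fin ifT ?lee_fin; lra.
have ig : (mu \x mu)%E.-integrable setT (EFin \o g).
  have -> : EFin \o g = (EFin \o g) \_ (J `*` J).
    apply/funext => -[r t]; rewrite patchE /=; case: ifPn => //.
    rewrite notin_setE /= => /not_andP[] /negP; rewrite /J /= in_itv /= -ler_norml -ltNge.
      by move=> /g1 ->.
    by move=> /g2 ->.
  apply: (iffLR (integrable_mkcond _ mJJ)).
  apply: measurable_bounded_integrable => //.
  - apply: (@le_lt_trans _ _ (mu J * mu J)%E); first by rewrite -(product_measure1E mu mu mJ mJ).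
    by apply: lte_mul_pinfty => //; rewrite ge0_fin_numE.
  - exact: measurable_funTS.
  - exists M; split; first by rewrite num_real.
    by move=> x Mx t _; apply: le_trans (gM t) (ltW Mx).
have E1 r : (\int[mu]_t (g (r, t))%:E)%E = (intR (fun t => g (r, t)))%:E.
  by rewrite fineK//; apply: integrable_fin_num => //; exact: (i1 r).
have E2 t : (\int[mu]_r (g (r, t))%:E)%E = (intR (fun r => g (r, t)))%:E.
  by rewrite fineK//; apply: integrable_fin_num => //; exact: (i2 t).
rewrite [LHS]/Rintegral [RHS]/Rintegral; congr fine.
under [in LHS]eq_integral => r _ do rewrite -E1.
under [in RHS]eq_integral => t _ do rewrite -E2.
exact: (Fubini ig).
Qed.

Lemma iint_swap m (F : measurableTypeR R -> (nat -> R) -> R) :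
  nice m F -> (forall r y, 1 < `|r| -> F r y = 0) ->
  intR (fun r => iint m (F r)) = iint m (fun y => intR (fun r => F r y)).
Proof.
move=> nF F1.
(* The parameter space must vary: each induction step moves one more coordinate into it, and [r] is
   kept as its last component. *)
suff H : forall d (X : measurableType d) (G : X * measurableTypeR R -> (nat -> R) -> R) x,
    nice m G -> (forall x r y, 1 < `|r| -> G (x, r) y = 0) ->
    intR (fun r => iint m (G (x, r))) = iint m (fun y => intR (fun r => G (x, r) y)).
  apply: (H _ _ (fun p : measurableTypeR R * measurableTypeR R => F p.2) 0) => [|x r y].
    by apply: (nice_fix _ nF); exact: measurable_snd.
  exact: F1.
elim: m {F nF F1} => [//|m IH] d X G x nG G1; rewrite !iintS.
have [mg [M gM]] := nice_iint (nice_scons nG).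
pose g (p : measurableTypeR R * measurableTypeR R) :=
  iint m (fun y => G (x, p.1) (scons p.2 y)).
have mg' : measurable_fun setT g.
  pose phi (p : measurableTypeR R * measurableTypeR R) := ((x, p.1), p.2).
  have mphi : measurable_fun setT phi.
    apply: measurable_fun_pair => //; exact: measurable_fun_pair.
  exact: (measurableT_comp mg mphi).
rewrite (@Rintegral_swap g M) //.
- apply: eq_Rintegral => t _; rewrite /g /=.
  apply: (IH _ _ (fun p y => G (p.1.1, p.2) (scons p.1.2 y)) (x, t : measurableTypeR R)).
  + have nG' := nice_scons nG.
    pose phi (p : X * measurableTypeR R * measurableTypeR R) := ((p.1.1, p.2), p.1.2).
    have mphi : measurable_fun setT phi.
      apply: measurable_fun_pair; last exact: measurableT_comp.
      by apply: measurable_fun_pair => //; exact: measurableT_comp.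
    exact: (nice_fix mphi nG').
  + by move=> [x' t'] r y r1 /=; exact: G1.
- by move=> z; exact: (gM ((x, z.1), z.2)).
- move=> r t r1; rewrite /g (@eq_iint _ _ (fun=> 0)) ?iint0// => y.
  exact: G1.
- move=> r t t1; rewrite /g (@eq_iint _ _ (fun=> 0)) ?iint0// => y.
  by case: nG => _ _ G0; apply: (G0 _ _ 0%N).
Qed.

End IteratedIntegral.

(** * Dilations, and integration in a single coordinate *)

Section Scaling.
Local Open Scope classical_set_scope.
Variable R : realType.
Notation mu := (@lebesgue_measure R).
Notation intR f := (Rintegral mu setT f).

(** By uniqueness of Lebesgue measure: the pushforward divided by [r] gives each half-open interval
    its length, since the preimage of []a, b]] is []r a, r b]]. *)
Lemma lebesgue_measure_scale (r : R) (A : set (measurableTypeR R)) : 0 < r ->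
  measurable A ->
  pushforward mu (fun t : measurableTypeR R => t / r : measurableTypeR R) A = (r%:E * mu A)%E.
Proof.
move=> r0 mA.
pose phi := fun t : measurableTypeR R => t / r : measurableTypeR R.
have mphi : measurable_fun setT phi by apply: measurable_funM.
have ri0 : 0 <= r^-1 by rewrite invr_ge0 ltW.
have [nu nuEE] : exists nu : {measure set (measurableTypeR R) -> \bar R},
    forall B, nu B = (r^-1%:E * pushforward mu phi B)%E.
  unshelve refine (ex_intro _
    (mscale (NngNum ri0) (pushforward mu phi) : {measure set _ -> \bar R}) _).
    exact: mphi.
  by [].
have nuE : forall A, measurable A -> mu A = nu A.
  apply: lebesgue_measure_unique => /= _ [[a b]] _ <-.
  rewrite nuEE /pushforward /=.
  have -> : phi @^-1` `]a, b] = `]r * a, r * b]%classic.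
    apply/seteqP; split => t /=; rewrite !in_itv /= /phi.
      by rewrite ltr_pdivlMr// ler_pdivrMr// mulrC (mulrC b).
    by rewrite ltr_pdivlMr// ler_pdivrMr// mulrC (mulrC b).
  rewrite [X in X = _](lebesgue_measure_itv `]a, b]%R).
  rewrite [X in (_ * X)%E](lebesgue_measure_itv `]r * a, r * b]%R) /=.
  rewrite !lte_fin ltr_pM2l//; case: ifPn => _; last by rewrite mule0.
  by rewrite -!EFinD -EFinM -mulrBr mulKf// gt_eqF.
by rewrite (nuE _ mA) nuEE muleA -EFinM divff ?mul1e// gt_eqF.
Qed.

Lemma Rintegral_scale (g : measurableTypeR R -> R) (M r : R) : 0 < r <= 1 ->
  measurable_fun setT g -> (forall t, `|g t| <= M) ->
  (forall t : R, 1 < `|t| -> g t = 0) ->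
  intR (fun t => g (t / r)) = r * intR g.
Proof.
move=> /andP[r0 r1] mg gM g0.
pose phi := fun t : measurableTypeR R => t / r : measurableTypeR R.
have mphi : measurable_fun setT phi by apply: measurable_funM.
have nuE A : measurable A -> pushforward mu phi A = mscale (NngNum (ltW r0)) mu A.
  exact: lebesgue_measure_scale.
rewrite -RintegralZl//; last exact: bounded_box_integrable gM g0.
rewrite /Rintegral; congr fine.
(* The change of variables is first made for nonnegative functions, then applied to the positive and
   negative parts of [g]. *)
have ige (h : measurableTypeR R -> \bar R) : measurable_fun setT h -> (forall x, 0 <= h x)%E ->
    (\int[mu]_t h (phi t) = r%:E * \int[mu]_t h t)%E.
  move=> mh h0; rewrite -(@ge0_integral_mscale _ _ _ mu setT measurableT (NngNum (ltW r0)))//.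
  rewrite -[LHS](@ge0_integral_pushforward _ _ _ _ _ phi mphi mu setT)//.
  by apply: eq_measure_integral => A mA _; exact: nuE.
have mEg : measurable_fun setT (EFin \o g) by exact/measurable_EFinP.
have -> : (\int[mu]_t (r * g t)%:E = r%:E * \int[mu]_t (g t)%:E)%E.
  under eq_integral do rewrite EFinM.
  by rewrite integralZl//; exact: bounded_box_integrable gM g0.
rewrite [LHS]integralE [X in (_ * X)%E]integralE muleBr//.
  congr (_ - _)%E.
    apply: etrans (ige _ (measurable_funepos mEg) _) => //.
    by apply: eq_integral => t _; rewrite !funeposE.
  apply: etrans (ige _ (measurable_funeneg mEg) _) => //.
  by apply: eq_integral => t _; rewrite !funenegE.
apply: fin_num_adde_defr; apply: integrable_pos_fin_num => //.
exact: bounded_box_integrable gM g0.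
Qed.

(** One factor [r] arises per coordinate. The bound [r <= 1] keeps the dilated integrand supported
    in [[-1, 1]]. *)
Lemma iint_scale m d (X : measurableType d) (F : X -> (nat -> R) -> R) x (r : R) :
  0 < r <= 1 -> nice m F ->
  iint m (fun y => F x (fun i => y i / r)) = r ^+ m * iint m (F x).
Proof.
move=> r01; elim: m d X F x => [|m IH] d X F x nF.
  by rewrite /= mul1r; congr F; apply/funext => i; rewrite mul0r.
rewrite !iintS.
have nF' := nice_scons nF.
have [mG [M GM]] := nice_iint nF'.
pose G (p : X * measurableTypeR R) := iint m (fun y => F p.1 (scons p.2 y)).
transitivity (intR (fun t : R => r ^+ m * G (x, t / r))).
  apply: eq_Rintegral => t _; rewrite /G -(IH _ _ _ _ nF') /=.
  apply: eq_iint => y; congr F; apply/funext => -[|i] //.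
have mGx : measurable_fun setT (fun t : measurableTypeR R => G (x, t)).
  by apply: (measurableT_comp mG); exact: pair1_measurable.
have Gx0 (t : R) : 1 < `|t| -> G (x, t) = 0.
  move=> t1; rewrite /G (@eq_iint _ _ _ (fun=> 0)) ?iint0// => y.
  by case: nF => _ _ F0; apply: (F0 _ _ 0%N).
have /andP[r0 r1] := r01.
rewrite exprSr -mulrA -(@Rintegral_scale (fun t => G (x, t)) M)//; last by move=> t; exact: GM.
rewrite RintegralZl//.
apply: (@bounded_box_integrable _ (fun t => G (x, t / r)) M).
- apply: (measurableT_comp mGx); exact: measurable_funM.
- by move=> t; exact: GM.
- move=> t t1; apply: Gx0.
  rewrite normrM (@ger0_norm _ r^-1) ?invr_ge0 ?(ltW r0)// ltr_pdivlMr// mul1r.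
  exact: le_lt_trans t1.
Qed.

Definition upd (i : nat) (t : R) (y : nat -> R) : nat -> R :=
  fun j => if j == i then t else y j.

(** If coordinate [i] is the outermost one, [iint_swap] moves it innermost, where its integral
    vanishes. Otherwise the outermost coordinate becomes a parameter and the induction hypothesis
    applies. *)
Lemma iint_coord_eq0 m d (X : measurableType d) (F : X -> (nat -> R) -> R) x i :
  (i < m)%N -> nice m F -> (forall x y, intR (fun t => F x (upd i t y)) = 0) ->
  iint m (F x) = 0.
Proof.
elim: m d X F x i => [//|m IH] d X F x [|i] im nF F0; rewrite iintS.
- rewrite (@iint_swap _ _ (fun t y => F x (scons t y))).
  + rewrite (@eq_iint _ _ _ (fun=> 0)) ?iint0// => y; rewrite -(F0 x (scons 0 y)).
    by apply: eq_Rintegral => t _; congr F; apply/funext => -[].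
  + have h : measurable_fun setT (fun t : measurableTypeR R => (x, t)).
      exact: pair1_measurable.
    exact: (nice_fix h (nice_scons nF)).
  + by case: nF => _ _ nF r y r1; apply: (nF _ _ 0%N).
- rewrite (_ : (fun _ => _) = cst 0) ?Rintegral_cst ?mul0r//.
  apply/funext => t /=.
  apply: (IH _ _ _ (x, t : measurableTypeR R) i im (nice_scons nF)) => -[x' s] y /=.
  rewrite -(F0 x' (scons s y)).
  by apply: eq_Rintegral => t' _; congr F; apply/funext => -[].
Qed.

End Scaling.

(** * Radial integration over the ball *)

Section Radial.
Local Open Scope classical_set_scope.
Variable R : realType.
Notation mu := (@lebesgue_measure R).
Notation intR f := (Rintegral mu setT f).

Lemma Rintegral_FTC (F f : R -> R) a b : a <= b ->
  (forall t : R, is_derive t 1 F (f t)) -> continuous f ->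
  intR (fun t => if a <= t <= b then f t else 0) = F b - F a.
Proof.
move=> ab Ff cf.
have -> : (fun t => if a <= t <= b then f t else 0) = f \_ `[a, b].
  apply/funext => t; rewrite patchE; case: ifPn => tab.
    by rewrite ifT// inE /= in_itv.
  by rewrite ifF//; apply/negbTE; rewrite notin_setE /= in_itv /=; apply/negP.
rewrite -Rintegral_mkcond.
move: ab; rewrite le_eqVlt => /predU1P[->|ab].
  by rewrite set_itv1 Rintegral_set1 subrr.
have cF : continuous F.
  move=> t; apply: differentiable_continuous; apply/derivable1_diffP.
  exact: ex_derive.
rewrite /Rintegral (@continuous_FTC2 _ f F)//.
- exact: continuous_subspaceT.
- split => //.
  + by apply: cvg_at_right_filter; exact: cF.
  + by apply: cvg_at_left_filter; exact: cF.
- by move=> t _; rewrite derive1E; exact: derive_val.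
Qed.

Lemma Rintegral_FTC_oc (F f : R -> R) a b : a <= b ->
  (forall t : R, is_derive t 1 F (f t)) -> continuous f ->
  intR (fun t => if a < t <= b then f t else 0) = F b - F a.
Proof.
move=> ab Ff cf; rewrite -(Rintegral_FTC ab Ff cf).
have -> : (fun t => if a < t <= b then f t else 0) = f \_ `]a, b].
  apply/funext => t; rewrite patchE; case: ifPn => tab.
    by rewrite ifT// inE /= in_itv.
  by rewrite ifF//; apply/negbTE; rewrite notin_setE /= in_itv /=; apply/negP.
have -> : (fun t => if a <= t <= b then f t else 0) = f \_ `[a, b].
  apply/funext => t; rewrite patchE; case: ifPn => tab.
    by rewrite ifT// inE /= in_itv.
  by rewrite ifF//; apply/negbTE; rewrite notin_setE /= in_itv /=; apply/negP.
rewrite -!Rintegral_mkcond Rintegral_itv_obnd_cbnd//.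
apply: (@integrableS _ _ _ mu `[a, b]) => //; first exact: subset_itv_oc_cc.
apply: continuous_compact_integrable; first exact: segment_compact.
exact: continuous_subspaceT.
Qed.

Lemma Rintegral_power (k a : R) q : 0 <= a <= 1 -> (0 < q)%N ->
  intR (fun r => if (0 < r <= 1) && (a <= r) then k * (q%:R * r ^+ q.-1) else 0) =
  k * (1 - a ^+ q).
Proof.
move=> /andP[a0 a1] q0.
pose F (r : R) := k * r ^+ q; pose f (r : R) := k * (q%:R * r ^+ q.-1).
have Ff (r : R) : is_derive r 1 F (f r).
  have H := is_deriveZ k (@is_deriveX R R id q r 1 1 (is_derive_id _ _)).
  have -> : F = k \*: (id ^+ q) by apply/funext => x; rewrite /F fctE.
  by apply: is_derive_eq; rewrite /f /GRing.scale /= mulr1.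
have cf : continuous f.
  move=> r; apply: cvgM; first exact: cvg_cst.
  by apply: cvgM; [exact: cvg_cst|exact: exprn_continuous].
have -> : k * (1 - a ^+ q) = F 1 - F a by rewrite /F expr1n mulrBr.
(* For [a = 0] the condition [0 < r] removes the left endpoint, so the half-open form of the
   fundamental theorem is needed. For [a > 0] that condition follows from [a <= r]. *)
have [->|an0] := eqVneq a 0.
  rewrite -(Rintegral_FTC_oc (@ler01 R) Ff cf); apply: eq_Rintegral => t _.
  by congr (if _ then _ else _); rewrite andbC; case: ltP => //=; [move=> /ltW ->|rewrite andbF].
have {an0}a0 : 0 < a by rewrite lt_neqAle eq_sym an0.
rewrite -(Rintegral_FTC a1 Ff cf); apply: eq_Rintegral => t _.
congr (if _ then _ else _); case: (leP a t) => at_; rewrite ?andbF//= andbT.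
by rewrite (lt_le_trans a0 at_).
Qed.

Lemma measurable_invr : measurable_fun setT (fun x : R => x^-1).
Proof.
have -> : setT = [set 0] `|` [set x : R | x != 0].
  by apply/seteqP; split => // x _ /=; case: (eqVneq x 0) => ?; [left|right].
have oN : open [set x : R | x != 0] by exact: open_neq.
apply/measurable_funU => //; first exact: open_measurable.
split; first exact: measurable_fun_set1.
apply: open_continuous_measurable_fun => //.
move=> x /[!inE] /= x0; exact: inv_continuous.
Qed.

Definition nsq n (y : nat -> R) : R := \sum_(i < n) y i ^+ 2.

Lemma nsq_ge0 n y : 0 <= nsq n y.
Proof. by apply: sumr_ge0 => i _; exact: sqr_ge0. Qed.

Lemma nsqZ n y (r : R) : nsq n (fun i => y i / r) = nsq n y / r ^+ 2.
Proof. by rewrite /nsq mulr_suml; apply: eq_bigr => i _; rewrite expr_div_n. Qed.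

Lemma nsq_gt1 n y i : (i < n)%N -> 1 < `|y i| -> 1 < nsq n y.
Proof.
move=> ilt yi; rewrite /nsq (bigD1 (Ordinal ilt))//=.
apply: (@lt_le_trans _ _ (y i ^+ 2)); last first.
  by rewrite lerDl; apply: sumr_ge0 => j _; exact: sqr_ge0.
by rewrite -real_normK ?num_real// exprn_egt1.
Qed.

Lemma measurable_nsq n d (Z : measurableType d) (y : Z -> nat -> R) :
  (forall i, measurable_fun setT (fun z => y z i)) ->
  measurable_fun setT (fun z => nsq n (y z)).
Proof. by move=> my; apply: measurable_sum => i; exact: measurable_funX. Qed.

Definition mble (h : (nat -> R) -> R) :=
  forall d (Z : measurableType d) (y : Z -> nat -> R),
    (forall i, measurable_fun setT (fun z => y z i)) ->
    measurable_fun setT (fun z => h (y z)).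

Definition onball n (h : (nat -> R) -> R) (y : nat -> R) : R :=
  if nsq n y <= 1 then h y else 0.

Lemma nice_scale n d (X : measurableType d) (F : X -> (nat -> R) -> R) (r : R) :
  0 < r <= 1 -> nice n F -> nice n (fun x y => F x (fun i => y i / r)).
Proof.
move=> /andP[r0 r1] [mF [M FM] F0]; split.
- move=> d' Z a y ma my; apply: (mF _ _ a (fun z i => y z i / r)) => // i.
  exact: measurable_funM.
- by exists M => x y; exact: FM.
- move=> x y i im yi; apply: (F0 _ _ i) => //.
  rewrite normrM (@ger0_norm _ r^-1) ?invr_ge0 ?(ltW r0)// ltr_pdivlMr// mul1r.
  exact: le_lt_trans yi.
Qed.

Lemma nice_onball n (h : (nat -> R) -> R) M d (X : measurableType d) : mble h ->
  (forall y, nsq n y <= 1 -> `|h y| <= M) -> nice n (fun (_ : X) => onball n h).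
Proof.
move=> mh hM; split.
- move=> d' Z a y _ my; rewrite /onball.
  apply: measurable_fun_ifT; [|exact: mh|exact: measurable_cst].
  by apply: measurable_fun_ler => //; exact: measurable_nsq.
- exists `|M| => x y; rewrite /onball; case: ifPn => [y1|_]; last by rewrite normr0.
  by apply: le_trans (hM y y1) (ler_norm _).
- move=> x y i im yi; rewrite /onball leNgt (nsq_gt1 im)//.
Qed.

(* Layer-cake: [|y|^q] is [1] minus the integral of [q r^(q-1)] over [|y| < r < 1],
   and the scaling of the measure evaluates each layer. *)
Lemma iint_radial n q (h : (nat -> R) -> R) M : mble h ->
  (forall y, nsq n y <= 1 -> `|h y| <= M) ->
  (forall (r : R) y, 0 < r -> h (fun i => y i / r) = h y) ->
  (n + q)%:R * iint n (onball n (fun y => Num.sqrt (nsq n y) ^+ q * h y)) =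
  n%:R * iint n (onball n h).
Proof.
move=> mh hM hZ; have [->|q0] := posnP q.
  by rewrite addn0; congr (_ * _); apply: eq_iint => y; rewrite /onball expr0 mul1r.
(* An arbitrary point of the parameter space, for integrands that do not depend on the parameter. *)
pose o : measurableTypeR R := 0.
pose c (r : R) : R := if 0 < r <= 1 then q%:R * r ^+ q.-1 else 0.
(* The layers. Integrating in [r] first gives [(1 - |y|^q) h] on the ball ([WE]); integrating in [y]
   first gives a factor [r^n] by scaling ([E]). The identity results from comparing the two
   orders. *)
pose W (r : measurableTypeR R) (y : nat -> R) := c r * onball n h (fun i => y i / r).
have cN r : `|c r| <= q%:R.
  rewrite /c; case: ifPn => [/andP[r0 r1]|_]; last by rewrite normr0.
  rewrite normrM ger0_norm// ler_piMr// ger0_norm; first by rewrite exprn_ile1// ltW.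
  by rewrite exprn_ge0// ltW.
have mc : measurable_fun setT (c : measurableTypeR R -> R).
  apply: measurable_fun_ifT => //.
  - apply: measurable_and.
      exact: measurable_fun_ltr.
    exact: measurable_fun_ler.
  - by apply: measurable_funM => //; exact: measurable_funX.
have nu : nice n (fun _ : measurableTypeR R => onball n h) by exact: nice_onball hM.
have nW : nice n W.
  split.
  - move=> d Z a y ma my; apply: measurable_funM; first exact: measurableT_comp.
    have [mu' _ _] := nu; apply: (mu' _ _ a (fun z i => y z i / a z)) => // i.
    by apply: measurable_funM => //; exact: (measurableT_comp measurable_invr).
  - have [_ [N uN] _] := nu; exists (q%:R * N) => r y.
    by rewrite normrM ler_pM//; exact: (uN 0).
  - move=> r y i im yi; rewrite /W /c; case: ifPn => [/andP[r0 r1]|_]; last by rewrite mul0r.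
    have [_ _ u0] := nu; rewrite (u0 0 _ i) ?mulr0//.
    rewrite normrM (@ger0_norm _ r^-1) ?invr_ge0 ?(ltW r0)// ltr_pdivlMr// mul1r.
    exact: le_lt_trans yi.
have nrm1 y : nsq n y <= 1 -> 0 <= Num.sqrt (nsq n y) <= 1.
  by move=> y1; rewrite sqrtr_ge0 -(@sqrtr1 R) ler_sqrt.
pose V := onball n (fun y => Num.sqrt (nsq n y) ^+ q * h y).
have WE y : intR (fun r => W r y) = onball n h y - V y.
  rewrite /V /onball; case: ifPn => y1; last first.
    rewrite subrr (_ : (fun _ => _) = cst 0) ?Rintegral_cst ?mul0r//.
    apply/funext => r; rewrite /W /c /onball nsqZ.
    case: ifPn => [/andP[r0 r1]|_]; last by rewrite mul0r.
    rewrite ifN ?mulr0// ler_pdivrMr ?exprn_gt0// mul1r -ltNge.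
    by apply: (@le_lt_trans _ _ 1); [rewrite exprn_ile1// ltW|rewrite ltNge].
  transitivity (h y * (1 - Num.sqrt (nsq n y) ^+ q)); last by ring.
  rewrite -(Rintegral_power (h y) (nrm1 _ y1) q0).
  apply: eq_Rintegral => r _; rewrite /W /c /onball nsqZ.
  case: ifPn => [/andP[r0 r1]|_] /=; last by rewrite mul0r.
  rewrite ler_pdivrMr ?exprn_gt0// mul1r hZ// -{1}(sqr_sqrtr (nsq_ge0 n y)).
  rewrite ler_pXn2r ?nnegrE ?sqrtr_ge0 ?(ltW r0)//.
  by case: ifP; rewrite ?mulr0// mulrC.
have nV : nice n (fun _ : measurableTypeR R => V).
  apply: (@nice_onball _ _ M) => [d Z y my|y y1].
    apply: measurable_funM; last exact: mh.
    apply: measurable_funX.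
    apply: (measurableT_comp (continuous_measurable_fun (@sqrt_continuous R))).
    exact: measurable_nsq.
  have /andP[a0 a1] := nrm1 y y1.
  rewrite normrM -[leRHS]mul1r ler_pM ?hM// ger0_norm ?exprn_ge0//.
  by rewrite exprn_ile1.
have E : iint n (fun y => intR (fun r => W r y)) = q%:R / (n + q)%:R * iint n (onball n h).
  rewrite -iint_swap//; last first.
    move=> r y r1; rewrite /W /c ifN ?mul0r//.
    by apply/negP => /andP[r0 r1']; move: r1; rewrite gtr0_norm// ltNge r1'.
  pose k := q%:R / (n + q)%:R * iint n (onball n h).
  have nq0 : (0 < n + q)%N by rewrite addn_gt0 q0 orbT.
  have h01 : 0 <= (0 : R) <= 1 by rewrite lexx ler01.
  (* This is the form of [Rintegral_power] with lower limit [0] and exponent [n + q]: the power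
     [r^(n+q-1)] collects [r^n] from scaling and [r^(q-1)] from the weight. *)
  transitivity (k * (1 - 0 ^+ (n + q))); last first.
    by rewrite expr0n (gtn_eqF nq0) subr0 mulr1.
  rewrite -(Rintegral_power k h01 nq0); apply: eq_Rintegral => r _.
  have [/andP[r0 r1]|r01] := boolP (0 < r <= 1); last first.
    rewrite /= (@eq_iint _ _ _ (fun=> 0)) ?iint0// => y.
    by rewrite /W /c (negbTE r01) mul0r.
  have nur : nice n (fun (_ : measurableTypeR R) y => onball n h (fun i => y i / r)).
    by apply: (@nice_scale _ _ _ (fun _ => onball n h)) nu; rewrite r0.
  rewrite (ltW r0) /= (@eq_iint _ _ _ (fun y => c r * onball n h (fun i => y i / r)))//.
  rewrite (iintZ o (c r) nur) (iint_scale o _ nu) ?r0// /c r0 r1 /= /k.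
  have -> : (n + q).-1 = (n + q.-1)%N by rewrite -subn1 -addnBA// subn1.
  rewrite exprD.
  by field; rewrite -natrD pnatr_eq0 addn_eq0 negb_and -!lt0n q0 orbT.
(* With [I] for the integral of [onball n h], the two orders give [I - iint n V = q / (n + q) * I],
   which is solved for [iint n V]. *)
move: E; rewrite (eq_iint _ WE).
have -> : iint n (fun y => onball n h y - V y) = iint n (onball n h) - iint n V.
  rewrite (eq_iint _ (fun y => esym (congr2 +%R erefl (mulN1r (V y))))).
  have nV1 : nice n (fun (_ : measurableTypeR R) y => -1 * V y).
    by apply: niceM nV => //; exists 1 => _; rewrite normrN1.
  by rewrite (iintD o nu nV1) (iintZ o (-1) nV) mulN1r.
have nq1 : (n + q)%:R != 0 :> R by rewrite pnatr_eq0 addn_eq0 negb_and -!lt0n q0 orbT.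
move=> /eqP; rewrite subr_eq addrC -subr_eq => /eqP <-.
rewrite mulrBr mulrA mulrCA divff// mulr1 -mulrBl natrD; congr (_ * _); ring.
Qed.

End Radial.

(** * Integrals of polynomials over the sphere *)

Section PolynomialIntegrals.
Local Open Scope classical_set_scope.
Variables (R : realType) (n : nat).
Notation mu := (@lebesgue_measure R).
Notation intR f := (Rintegral mu setT f).
Notation poly := (mpoly.mpoly n R).
Implicit Types (p q F : poly) (y : nat -> R).

Definition mvar (i : 'I_n) : poly := mpoly.mpolyX R (mpoly.mnm1 i).

Definition pt (y : nat -> R) : 'I_n -> R := fun i => y (val i).

Definition peval p y : R := mpoly.meval (pt y) p.

Lemma meval_homog k p (c : R) (x : 'I_n -> R) :
  p \is @mpoly.ishomog1 n R k mpoly.mdeg ->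
  mpoly.meval (fun i => c * x i) p = c ^+ k * mpoly.meval x p.
Proof.
move=> /mpoly.dhomogP hp; rewrite !mpoly.mevalE mulr_sumr.
rewrite big_seq [RHS]big_seq; apply: eq_bigr => m /hp mk.
under eq_bigr do rewrite exprMn.
by rewrite big_split /= prodrXr -mpoly.mdegE mk mulrCA.
Qed.

Lemma mble_peval p : mble (peval p).
Proof.
move=> d Z y my; rewrite /peval.
under eq_fun do rewrite mpoly.mevalE.
apply: measurable_sum => m; apply: measurable_funM => //.
by apply: measurable_prod => i _; apply: measurable_funX; exact: my.
Qed.

Lemma nsq_le1 y (i : 'I_n) : nsq n y <= 1 -> `|y i| <= 1.
Proof.
by move=> y1; rewrite leNgt; apply/negP => /(nsq_gt1 (ltn_ord i)); rewrite ltNge y1.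
Qed.

Lemma peval_bounded p y : nsq n y <= 1 ->
  `|peval p y| <= \sum_(m <- mpoly.msupp p) `|mpoly.mcoeff m p|.
Proof.
move=> y1; rewrite /peval mpoly.mevalE.
apply: le_trans (ler_norm_sum _ _ _) _; apply: ler_sum => m _.
rewrite normrM ler_piMr// normr_prod; apply: prodr_ile1 => i _.
by rewrite normr_ge0 normrX exprn_ile1// (nsq_le1 _ y1).
Qed.

Lemma nice_peval p : nice n (fun _ : measurableTypeR R => onball n (peval p)).
Proof. by apply: nice_onball (@peval_bounded p); exact: mble_peval. Qed.

(** The extension of [p] from the sphere that is constant along rays. At the origin division by zero
    returns [0], so the value there is that of [p] at [0]. *)
Definition sph p y : R := peval p (fun i => y i / Num.sqrt (nsq n y)).

Lemma mble_sph p : mble (sph p).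
Proof.
move=> d Z y my; apply: mble_peval => i; apply: measurable_funM => //.
apply: (measurableT_comp (@measurable_invr R)).
apply: (measurableT_comp (continuous_measurable_fun (@sqrt_continuous R))).
exact: measurable_nsq.
Qed.

(** Only an inequality, because the normalized origin is the origin. *)
Lemma nsq_unit y : nsq n (fun i => y i / Num.sqrt (nsq n y)) <= 1.
Proof.
rewrite nsqZ sqr_sqrtr ?nsq_ge0//.
by have [->|y0] := eqVneq (nsq n y) 0; rewrite ?mul0r ?ler01// divff.
Qed.

Lemma sph_bounded p y : nsq n y <= 1 ->
  `|sph p y| <= \sum_(m <- mpoly.msupp p) `|mpoly.mcoeff m p|.
Proof. by move=> _; apply: peval_bounded; exact: nsq_unit. Qed.

Lemma sphZ p (r : R) y : 0 < r -> sph p (fun i => y i / r) = sph p y.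
Proof.
move=> r0; rewrite /sph; congr peval; apply/funext => i.
rewrite nsqZ sqrtrM ?nsq_ge0// sqrtrV ?exprn_ge0 ?ltW// sqrtr_sqr gtr0_norm//.
rewrite invfM invrK -!mulrA; congr (_ * _).
by rewrite mulrCA mulVf ?mulr1// gt_eqF.
Qed.

Lemma sph_homog k p y : p \is @mpoly.ishomog1 n R k mpoly.mdeg ->
  Num.sqrt (nsq n y) ^+ k * sph p y = peval p y.
Proof.
move=> hp; rewrite /sph /peval -(meval_homog _ _ hp); apply: mpoly.meval_eq => i.
rewrite /pt; have [s0|s0] := eqVneq (Num.sqrt (nsq n y)) 0; last first.
  by rewrite mulrCA divff// mulr1.
rewrite s0 mul0r; apply/esym/eqP; rewrite -sqrf_eq0 eq_le sqr_ge0 andbT.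
have <- : nsq n y = 0 by rewrite -(sqr_sqrtr (nsq_ge0 n y)) s0 expr0n.
rewrite /nsq (bigD1 i)//= lerDl.
by apply: sumr_ge0 => j _; exact: sqr_ge0.
Qed.

Fact Sint_key : unit. Proof. by []. Qed.

(* Locked: unification would otherwise see [Sint p], a product by its definition,
   as an instance of the ring operations. *)
Definition Sint : poly -> R :=
  locked_with Sint_key (fun p => sphint (fun x => mpoly.meval x p)).

Lemma sphint_meval p : sphint (fun x => mpoly.meval x p) = Sint p.
Proof. by rewrite [Sint]unlock. Qed.

Lemma SintE p : Sint p = n%:R * iint n (onball n (sph p)).
Proof.
have dotE y : dotp (pt y) (pt y) = nsq n y.
  by apply: eq_bigr => i _; rewrite expr2.
rewrite -sphint_meval /sphint; congr (_ * _); apply: eq_iint => y.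
Qed.

Lemma nice_sph p : nice n (fun _ : measurableTypeR R => onball n (sph p)).
Proof. by apply: nice_onball (@sph_bounded p); exact: mble_sph. Qed.

Lemma SintD p q : Sint (p + q) = Sint p + Sint q.
Proof.
rewrite !SintE -mulrDr -(iintD (0 : measurableTypeR R) (nice_sph p) (nice_sph q)).
congr (_ * _); apply: eq_iint => y; rewrite /onball /sph /peval mpoly.mevalD.
by case: ifP; rewrite ?addr0.
Qed.

Lemma SintZ (c : R) p : Sint (c *: p) = c * Sint p.
Proof.
rewrite !SintE mulrCA -(iintZ (0 : measurableTypeR R) c (nice_sph p)).
congr (_ * _); apply: eq_iint => y; rewrite /onball /sph /peval mpoly.mevalZ.
by case: ifP; rewrite ?mulr0.
Qed.

(** By homogeneity [|y|^e p] is [|y|^(k+e)] times a function constant along rays, so [iint_radial]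
    applies. The cases [e = 0] and [e = 2] turn ball integrals of [p] and of [|y|^2 p] into the same
    spherical integral. *)
Lemma Sint_radial k e p : p \is @mpoly.ishomog1 n R k mpoly.mdeg ->
  (n + (k + e))%:R * iint n (onball n (fun y => Num.sqrt (nsq n y) ^+ e * peval p y)) = Sint p.
Proof.
move=> hp; rewrite SintE.
rewrite -(@iint_radial _ n (k + e) (sph p) _ (@mble_sph p) (@sph_bounded p) (@sphZ p)).
congr (_ * _); apply: eq_iint => y; rewrite /onball -(sph_homog _ hp).
by rewrite mulrA -exprD addnC.
Qed.

End PolynomialIntegrals.

(** * Integration by parts over the ball and the sphere *)

Section PolynomialIntegrals.
Local Open Scope classical_set_scope.
Variables (R : realType) (n : nat).
Notation mu := (@lebesgue_measure R).
Notation intR f := (Rintegral mu setT f).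
Notation poly := (mpoly.mpoly n R).
Implicit Types (p q F : poly) (y : nat -> R).

Notation mvar := (@mvar R n).
Lemma mderiv_mvar (i j : 'I_n) : mpoly.mderiv i (mvar j) = (i == j)%:R.
Proof.
rewrite mpoly.mderivX mpoly.mnm1E eq_sym; case: eqVneq => [->|_]; last by rewrite scale0r.
rewrite scale1r -mpoly.mpolyX0; congr mpoly.mpolyX; apply/mpoly.mnmP => k.
by rewrite mpoly.mnmBE subnn mpoly.mnm0E.
Qed.

Lemma is_derive_peval p (i : 'I_n) y (t : R) :
  is_derive t 1 (fun t : R => peval p (upd i t y)) (peval (mpoly.mderiv i p) (upd i t y)).
Proof.
(* The formal derivative is the analytic one: [Q] holds for constants and variables and is stable
   under sums, products and scalar multiples, hence holds for every polynomial. *)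
pose Q p := forall t : R, is_derive t 1 (fun t : R => peval p (upd i t y))
  (peval (mpoly.mderiv i p) (upd i t y)).
have QE p1 (f : R -> R) (s df : R) : is_derive s 1 f df ->
    f =1 (fun t => peval p1 (upd i t y)) -> df = peval (mpoly.mderiv i p1) (upd i s y) ->
    is_derive s 1 (fun t : R => peval p1 (upd i t y)) (peval (mpoly.mderiv i p1) (upd i s y)).
  by move=> + /funext <- <-.
have QM p1 p2 : Q p1 -> Q p2 -> Q (p1 * p2).
  move=> h1 h2 s; apply: (QE _ _ _ _ (is_deriveM (h1 s) (h2 s))) => [u|].
    by rewrite /peval mpoly.mevalM.
  rewrite /peval mpoly.mderivM mpoly.mevalD !mpoly.mevalM /GRing.scale /=; ring.
have QD p1 p2 : Q p1 -> Q p2 -> Q (p1 + p2).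
  move=> h1 h2 s; apply: (QE _ _ _ _ (is_deriveD (h1 s) (h2 s))) => [u|].
    by rewrite /peval mpoly.mevalD.
  by rewrite /peval mpoly.mderivD mpoly.mevalD.
have QZ c p1 : Q p1 -> Q (c *: p1).
  move=> h1 s; apply: (QE _ _ _ _ (is_deriveZ c (h1 s))) => [u|].
    by rewrite /peval mpoly.mevalZ.
  by rewrite /peval mpoly.mderivZ mpoly.mevalZ.
have QC c : Q (mpoly.mpolyC n c).
  move=> s; apply: (QE _ _ _ _ (is_derive_cst c s 1)) => [u|].
    by rewrite /peval mpoly.mevalC.
  by rewrite /peval mpoly.mderivC mpoly.meval0.
have QX j : Q (mvar j).
  move=> s; have [ji|ji] := eqVneq i j.
    apply: (QE _ _ _ _ (is_derive_id s 1)) => [u|].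
      by rewrite /peval mpoly.mevalXU /pt /upd ji eqxx.
    by rewrite /peval mderiv_mvar ji eqxx mpoly.meval1.
  apply: (QE _ _ _ _ (is_derive_cst (y j) s 1)) => [u|].
    by rewrite /peval mpoly.mevalXU /pt /upd val_eqE eq_sym (negbTE ji).
  by rewrite /peval mderiv_mvar (negbTE ji) mpoly.meval0.
move: t; rewrite -/(Q p); elim/mpoly.mpolyind: p => [|c m p _ _ IH].
  by rewrite -(mpoly.mpolyC0 n R); exact: QC.
apply: (QD _ _ _ IH); apply: QZ; rewrite mpoly.mpolyXE_id.
apply: (big_ind Q) => [||j _]; [by rewrite -(mpoly.mpolyC1 n R); exact: QC|exact: QM|].
elim: (m j) => [|k IHk]; first by rewrite expr0 -(mpoly.mpolyC1 n R); exact: QC.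
by rewrite exprS; exact: QM (QX j) IHk.
Qed.

Definition normsq : poly := \sum_(j < n) mvar j ^+ 2.

Lemma meval_normsq y : peval normsq y = nsq n y.
Proof.
rewrite /peval /normsq mpoly.mevalE -mpoly.mevalE raddf_sum /=; apply: eq_bigr => j _.
by rewrite !expr2 mpoly.mevalM mpoly.mevalXU.
Qed.

Lemma mderiv_normsq (i : 'I_n) : mpoly.mderiv i normsq = 2 *: mvar i.
Proof.
rewrite /normsq raddf_sum /= (bigD1 i)//= big1 ?addr0 => [|j ji].
  by rewrite expr2 mpoly.mderivM mderiv_mvar eqxx mul1r mulr1 scaler_nat mulr2n.
by rewrite expr2 mpoly.mderivM mderiv_mvar eq_sym (negbTE ji) mul0r mulr0 addr0.
Qed.

Lemma nsq_upd (i : 'I_n) (t : R) y : nsq n (upd i t y) = t ^+ 2 + \sum_(j < n | j != i) y j ^+ 2.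
Proof.
rewrite /nsq (bigD1 i)//= /upd eqxx; congr (_ + _).
by apply: eq_bigr => j ji; rewrite val_eqE (negbTE ji).
Qed.

(** A line parallel to the axis [i] misses the ball, or meets it in a segment with both endpoints on
    the sphere. There [P] vanishes, and the fundamental theorem gives [0]. *)
Lemma Rintegral_mderiv_eq0 P (i : 'I_n) y : (forall y, nsq n y = 1 -> peval P y = 0) ->
  intR (fun t => onball n (peval (mpoly.mderiv i P)) (upd i t y)) = 0.
Proof.
move=> P0; pose c := \sum_(j < n | j != i) y j ^+ 2.
have E t : (nsq n (upd i t y) <= 1) = (t ^+ 2 <= 1 - c).
  by rewrite nsq_upd lerBrDr.
have [c1|c1] := ltP (1 - c) 0.
  rewrite (_ : (fun _ => _) = cst 0) ?Rintegral_cst ?mul0r//.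
  apply/funext => t; rewrite /onball E ifN// -ltNge.
  by apply: (lt_le_trans c1); exact: sqr_ge0.
pose b := Num.sqrt (1 - c).
have b0 : 0 <= b by exact: sqrtr_ge0.
have E' t : (nsq n (upd i t y) <= 1) = (- b <= t <= b).
  rewrite E -ler_norml -{1}(sqr_sqrtr c1) -[t ^+ 2]real_normK ?num_real//.
  by rewrite ler_pXn2r ?nnegrE.
have bb : - b <= b by lra.
pose f t := peval (mpoly.mderiv i P) (upd i t y).
have cf : continuous f.
  move=> t; apply: differentiable_continuous; apply/derivable1_diffP.
  have H : is_derive t 1 f _ := @is_derive_peval (mpoly.mderiv i P) i y t.
  exact: ex_derive.
have := Rintegral_FTC bb (@is_derive_peval P i y) cf.
rewrite !P0 ?subrr => [<-||].
- by apply: eq_Rintegral => t _; rewrite /onball E'.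
- by rewrite nsq_upd sqrrN sqr_sqrtr// -/c subrK.
- by rewrite nsq_upd sqr_sqrtr// -/c subrK.
Qed.

Definition ballint p : R := iint n (onball n (peval p)).

Lemma ballintD p q : ballint (p + q) = ballint p + ballint q.
Proof.
rewrite /ballint -(iintD (0 : measurableTypeR R) (nice_peval p) (nice_peval q)).
apply: eq_iint => y; rewrite /onball /peval mpoly.mevalD.
by case: ifP; rewrite ?addr0.
Qed.

Lemma ballintZ (c : R) p : ballint (c *: p) = c * ballint p.
Proof.
rewrite /ballint -(iintZ (0 : measurableTypeR R) c (nice_peval p)).
apply: eq_iint => y; rewrite /onball /peval mpoly.mevalZ.
by case: ifP; rewrite ?mulr0.
Qed.

Lemma ballint_mderiv_eq0 P (i : 'I_n) : (forall y, nsq n y = 1 -> peval P y = 0) ->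
  ballint (mpoly.mderiv i P) = 0.
Proof.
move=> P0; have nP := nice_peval (mpoly.mderiv i P).
apply: (@iint_coord_eq0 _ n _ _ _ (0 : measurableTypeR R) i (ltn_ord i) nP) => _ y.
exact: Rintegral_mderiv_eq0.
Qed.

Lemma mvar_homog i : mvar i \is @mpoly.ishomog1 n R 1 mpoly.mdeg.
Proof. by rewrite mpoly.dhomogX; apply/eqP; exact: mpoly.mdeg1. Qed.

Lemma mderiv_homog k p i : p \is @mpoly.ishomog1 n R k mpoly.mdeg ->
  mpoly.mderiv i p \is @mpoly.ishomog1 n R k.-1 mpoly.mdeg.
Proof.
move=> /mpoly.dhomogP hp; apply/mpoly.dhomogP => m.
rewrite mpoly.mcoeff_msupp mpoly.mcoeff_mderiv => h.
have : mpoly.mnm_add m (mpoly.mnm1 i) \in mpoly.msupp p.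
  by rewrite mpoly.mcoeff_msupp; apply: contraNneq h => ->; rewrite mul0rn.
move=> /hp h'; have {h'} : mpoly.mdeg (mpoly.mnm_add m (mpoly.mnm1 i)) = k := h'.
by rewrite mpoly.mdegD mpoly.mdeg1 addn1 => <-.
Qed.

Lemma mderiv_homog0 p i : p \is @mpoly.ishomog1 n R 0 mpoly.mdeg -> mpoly.mderiv i p = 0.
Proof.
move=> /mpoly.dhomogP hp; apply/mpoly.mpolyP => m; rewrite mpoly.mcoeff0 mpoly.mcoeff_mderiv.
rewrite mpoly.memN_msupp_eq0 ?mul0rn//; apply/negP => /hp h'.
have {h'} : mpoly.mdeg (mpoly.mnm_add m (mpoly.mnm1 i)) = 0%N := h'.
by rewrite mpoly.mdegD mpoly.mdeg1 addn1.
Qed.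

Lemma Sint_parts k F i : (0 < n)%N -> F \is @mpoly.ishomog1 n R k mpoly.mdeg ->
  Sint (mpoly.mderiv i F) = (k + n.-1)%:R * Sint (mvar i * F).
Proof.
move=> n0 hF.
have hD := mderiv_homog i hF.
have hX : mvar i * F \is @mpoly.ishomog1 n R (1 + k) mpoly.mdeg.
  by apply: mpoly.dhomogM => //; exact: mvar_homog.
pose D := mpoly.mderiv i F.
(* For [k > 0], [D] has degree [k - 1], and [|x|^2 D] and [x_i F] have degree [k + 1]. This fixes
   the factors in [E0], [E1], [E2]; the vanishing integral of the derivative of [P] is the linear
   relation [E3], and elimination finishes. *)
pose N0 := ballint D.
pose N1 := ballint (normsq * D).
pose N2 := ballint (mvar i * F).
have E0 : (n + k.-1)%:R * N0 = Sint D.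
  rewrite -(Sint_radial 0 hD) addn0; congr (_ * _); apply: eq_iint => y.
  by rewrite /onball expr0 mul1r.
have E1 : (n + k.-1 + 2)%:R * N1 = Sint D.
  rewrite -(Sint_radial 2 hD) addnA; congr (_ * _); apply: eq_iint => y.
  by rewrite /onball sqr_sqrtr ?nsq_ge0// -meval_normsq /peval mpoly.mevalM.
have E2 : (n + k.+1)%:R * N2 = Sint (mvar i * F).
  rewrite -(Sint_radial 0 hX) addn0 add1n; congr (_ * _); apply: eq_iint => y.
  by rewrite /onball expr0 mul1r.
pose P := F * (1 - normsq).
have P0 y : nsq n y = 1 -> peval P y = 0.
  rewrite /peval mpoly.mevalM mpoly.mevalB mpoly.meval1 -/(peval normsq y) meval_normsq => ->.
  by rewrite subrr mulr0.
have dP : mpoly.mderiv i P = D + ((-1) *: (normsq * D) + (-2) *: (mvar i * F)).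
  rewrite /P mpoly.mderivM mpoly.mderivB -{2}(mpoly.mpolyC1 n R) mpoly.mderivC mderiv_normsq -/D.
  rewrite mulrBr mulr1 sub0r mulrN scaleN1r -scalerAr scaleNr (mulrC F) (mulrC normsq).
  by rewrite addrA.
have E3 : N0 - N1 - 2 * N2 = 0.
  rewrite -(ballint_mderiv_eq0 i P0) dP !ballintD !ballintZ /N0 /N1 /N2; ring.
(* For [k = 0] the truncated [k.-1] breaks the degree count. But then [D = 0], so [N0] and [N1]
   vanish and [E3] gives [N2 = 0]: both sides are zero. *)
have [k0|k0] := posnP k.
  have D0 : Sint D = 0.
    have -> : D = 0 by apply: mderiv_homog0; move: hF; rewrite k0.
    by have := SintZ 0 (0 : poly); rewrite scale0r mul0r.
  have z m N : (n + m)%:R * N = 0 :> R -> N = 0.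
    move=> /eqP; rewrite mulf_eq0 pnatr_eq0 addn_eq0 (gtn_eqF n0) /=.
    by move/eqP.
  move: E0 E1; rewrite D0 -addnA => /z z0 /z z1.
  have N20 : N2 = 0 by move: E3; rewrite z0 z1; lra.
  by rewrite -E2 N20 !mulr0.
rewrite -/D -E2; move: E0 E1 E2 E3.
have -> : (k + n.-1 = n + k.-1)%N by rewrite addnC -{1}(prednK k0) addnS -addSn prednK.
have -> : (n + k.+1 = n + k.-1 + 2)%N by rewrite -{1}(prednK k0) addn2 !addnS.
set a := (n + k.-1)%N; rewrite natrD => E0 E1 _ E3.
have -> : Sint D = a%:R * ((a%:R + 2%:R) * ((N0 - N1) / 2)).
  rewrite -E1; have := E0; rewrite -E1 => h.
  have -> : a%:R * ((a%:R + 2%:R) * ((N0 - N1) / 2)) =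
    (a%:R * N0 - a%:R * N1) * (a%:R + 2%:R) / 2 by ring.
  by rewrite h; field.
have N2E : (N0 - N1) / 2 = N2 by lra.
by rewrite N2E.
Qed.

Lemma iint_prod m (g : measurableTypeR R -> R) : measurable_fun setT g ->
  (forall t, 0 <= g t <= 1) -> (forall t : R, 1 < `|t| -> g t = 0) ->
  nice m (fun (_ : measurableTypeR R) y => \prod_(i < m) g (y i)) /\
  iint m (fun y => \prod_(i < m) g (y i)) = intR g ^+ m.
Proof.
move=> mg g01 g0.
have nP m' : nice m' (fun (_ : measurableTypeR R) y => \prod_(i < m') g (y i)).
  split.
  - move=> d Z a y _ my; apply: measurable_prod => i _; exact: measurableT_comp.
  - exists 1 => _ y; rewrite ger0_norm; last by apply: prodr_ge0 => i _; case/andP: (g01 (y i)).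
    by apply: prodr_ile1 => i _.
  - by move=> _ y i im yi; rewrite (bigD1 (Ordinal im))//= g0 ?mul0r.
split; first exact: nP.
elim: m => [|m IH]; first by rewrite /= big_ord0.
rewrite iintS exprS -RintegralZr//; last first.
  apply: (@bounded_box_integrable _ g 1) => // t.
  by case/andP: (g01 t) => g1 g2; rewrite ger0_norm.
apply: eq_Rintegral => t _.
rewrite -IH -(iintZ (0 : measurableTypeR R) (g t) (nP m)).
by apply: eq_iint => y; rewrite big_ord_recl.
Qed.

(** The ball contains a cube, whose volume [iint_prod] evaluates as a product of positive side
    lengths. *)
Lemma Sint1_gt0 : (0 < n)%N -> 0 < Sint (1 : poly).
Proof.
move=> n0; rewrite SintE mulr_gt0 ?ltr0n//.
(* Half the side of the cube: from [|y_i| <= e] follows [y_i^2 <= e^2 <= e], and the [n] terms add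
   up to at most [n e = 1]. *)
pose e : R := n%:R^-1.
have n1 : 1 <= n%:R :> R by rewrite ler1n.
have e0 : 0 < e by rewrite invr_gt0 ltr0n.
have e1 : e <= 1 by rewrite invf_le1// ltr0n.
pose g (t : measurableTypeR R) : R := if - e <= t <= e then 1 else 0.
have mg : measurable_fun setT g.
  apply: measurable_fun_ifT => //; apply: measurable_and; exact: measurable_fun_ler.
have g01 t : 0 <= g t <= 1 by rewrite /g; case: ifP; rewrite ?ler01 ?lexx.
have g0 (t : R) : 1 < `|t| -> g t = 0.
  move=> t1; rewrite /g ifF// -ler_norml; apply/negbTE; rewrite -ltNge.
  exact: le_lt_trans t1.
have [nP iP] := iint_prod n mg g01 g0.
have gE : intR g = e - (- e).
  have ee : - e <= e by lra.
  have d1 (t : R) : is_derive t 1 (id : R -> R) (cst 1 t) by exact: is_derive_id.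
  have c1 : continuous (cst 1 : R -> R) by move=> t; exact: cvg_cst.
  by rewrite -(Rintegral_FTC ee d1 c1).
have : 0 < intR g ^+ n by rewrite exprn_gt0// gE; lra.
move/lt_le_trans; apply; rewrite -iP.
have := le_iint (x := 0 : measurableTypeR R) nP (nice_sph (1 : poly)); rewrite /=; apply => y.
have [y1|y1] := boolP [forall i : 'I_n, - e <= y i <= e].
  rewrite /onball ifT; first by rewrite /sph /peval mpoly.meval1 prodr_ile1.
  apply: (@le_trans _ _ (\sum_(i < n) e)).
    apply: ler_sum => i _; rewrite -real_normK ?num_real//.
    have yi : `|y i| <= e by rewrite ler_norml; exact: (forallP y1).
    apply: le_trans (_ : e ^+ 2 <= e); first by rewrite ler_pXn2r ?nnegrE ?(ltW e0).
    by rewrite expr2 ler_piMr// ltW.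
  by rewrite sumr_const card_ord -mulr_natr mulVf// gt_eqF// ltr0n.
move: y1; rewrite negb_forall => /existsP[i yi].
rewrite (bigD1 i)//= {1}/g (negbTE yi) mul0r /onball.
by case: ifP => // _; rewrite /sph /peval mpoly.meval1 ler01.
Qed.

End PolynomialIntegrals.

(** * Spherical harmonics *)

Section SphericalHarmonics.
Variables (R : realType) (n : nat).
Notation poly := (mpoly.mpoly n R).
Notation mvar := (@mvar R n).
Notation D := (@mpoly.mderiv n R).
Notation homog k p := (p \is @mpoly.ishomog1 n R k mpoly.mdeg).
Implicit Types (p q g : poly) (v w u : polymap R n) (x : 'I_n -> R).

Lemma Sint0 : Sint (0 : poly) = 0.
Proof. by have := SintZ 0 (0 : poly); rewrite scale0r mul0r. Qed.

Lemma Sint_sum (I : Type) (r : seq I) (P : pred I) (F : I -> poly) :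
  Sint (\sum_(i <- r | P i) F i) = \sum_(i <- r | P i) Sint (F i).
Proof. by apply: (big_morph _ (@SintD R n) Sint0). Qed.

Lemma SintB p q : Sint (p - q) = Sint p - Sint q.
Proof. by rewrite SintD -scaleN1r SintZ mulN1r. Qed.

(** The cone formula samples the integrand at the origin when [y = 0], since division by zero
    returns [0]. Asking for agreement there makes the integrands equal pointwise, with no null-set
    argument. *)
Lemma sphint_ext (f1 f2 : ('I_n -> R) -> R) :
  (forall x, dotp x x = 1 -> f1 x = f2 x) -> f1 (fun _ => 0) = f2 (fun _ => 0) ->
  sphint f1 = sphint f2.
Proof.
move=> f12 f0; rewrite /sphint; congr (_ * _); apply: eq_iint => y /=.
case: ifP => // _; set s := dotp _ _.
have s0 : 0 <= s by apply: sumr_ge0 => i _; rewrite -expr2 sqr_ge0.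
have [sz|snz] := eqVneq s 0.
  rewrite sz sqrtr0 invr0 (_ : (fun _ => _) = (fun _ => 0)) //.
  by apply/funext => i; rewrite mulr0.
apply: f12; rewrite -(divff snz) -{4}(sqr_sqrtr s0) {3}/s /dotp mulr_suml.
apply: eq_bigr => i _; rewrite expr2 invfM; ring.
Qed.

Lemma euler k p : homog k p -> \sum_(i < n) mvar i * D i p = k%:R *: p.
Proof.
move=> /mpoly.dhomogP hp.
have E m : \sum_(i < n) mvar i * D i (mpoly.mpolyX R m) =
    (mpoly.mdeg m)%:R *: mpoly.mpolyX R m :> poly.
  rewrite mpoly.mdegE natr_sum scaler_suml; apply: eq_bigr => i _.
  rewrite mpoly.mderivX -scalerAr; have [->|mi] := posnP (m i); first by rewrite !scale0r.
  congr (_ *: _); rewrite -mpoly.mpolyXD; congr mpoly.mpolyX; apply/mpoly.mnmP => j.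
  rewrite mpoly.mnmDE mpoly.mnmBE mpoly.mnm1E subnKC//.
  by case: eqVneq => // <-.
rewrite {1 2}[p]mpoly.mpolyE.
under eq_bigr do rewrite raddf_sum mulr_sumr.
rewrite exchange_big /= scaler_sumr big_seq [RHS]big_seq; apply: eq_bigr => m /hp mk.
under eq_bigr do rewrite mpoly.mderivZ -scalerAr.
rewrite -scaler_sumr E scalerA scalerA mulrC; congr (_ * _ *: _).
by rewrite -mk.
Qed.

Lemma plapD p q : plap (p + q) = plap p + plap q.
Proof. by rewrite /plap -big_split; apply: eq_bigr => i _; rewrite !raddfD. Qed.

Lemma plapZ (c : R) p : plap (c *: p) = c *: plap p.
Proof. by rewrite /plap scaler_sumr; apply: eq_bigr => i _; rewrite !mpoly.mderivZ. Qed.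

Lemma plap_sum (F : 'I_n -> poly) : plap (\sum_i F i) = \sum_i plap (F i).
Proof.
apply: (big_morph _ plapD); rewrite /plap big1// => i _.
by rewrite !raddf0.
Qed.

Lemma plapM p q :
  plap (p * q) = plap p * q + 2 *: (\sum_(i < n) D i p * D i q) + p * plap q.
Proof.
rewrite /plap mulr_suml mulr_sumr scaler_sumr -!big_split; apply: eq_bigr => i _ /=.
by rewrite mpoly.mderivM raddfD /= !mpoly.mderivM scaler_nat; ring.
Qed.

Lemma hharmD k p q : hharm k p -> hharm k q -> hharm k (p + q).
Proof.
move=> [hp lp] [hq lq]; split; first exact: mpoly.dhomogD.
by rewrite /harmonic_poly plapD lp lq addr0.
Qed.

Lemma hharmZ k (c : R) p : hharm k p -> hharm k (c *: p).
Proof.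
move=> [hp lp]; split; first exact: mpoly.dhomogZ.
by rewrite /harmonic_poly plapZ lp scaler0.
Qed.

Lemma hharm0 k : hharm k (0 : poly).
Proof.
split; first exact: mpoly.dhomog0.
by rewrite /harmonic_poly /plap big1// => i _; rewrite !raddf0.
Qed.

Lemma hharm_mderiv k p i : hharm k p -> hharm k.-1 (D i p).
Proof.
move=> [hp lp]; split; first exact: mderiv_homog.
rewrite /harmonic_poly; transitivity (D i (plap p)); last by rewrite lp raddf0.
rewrite /plap raddf_sum /=; apply: eq_bigr => j _.
by rewrite !(mpoly.mderiv_comm i j).
Qed.

(** As [q] is harmonic, the integrand is the divergence of [p grad q]. Integration by parts yields
    the normal derivative of [q], which is [b q] by Euler. *)
Lemma Sint_dot_mderiv a b p q : (0 < n)%N -> homog a p -> hharm b q ->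
  Sint (\sum_(i < n) D i p * D i q) = (a%:R + b%:R + n%:R - 2) * b%:R * Sint (p * q).
Proof.
(* For [b = 0] the predecessor [b.-1] is truncated; [q] is then constant and both sides vanish. *)
move=> n0 hp [hq lq]; have [b0|b0] := posnP b.
  rewrite b0 mulr0 mul0r Sint_sum big1// => i _.
  by rewrite (@mderiv_homog0 _ _ q) ?mulr0 ?Sint0//; move: hq; rewrite b0.
have -> : \sum_(i < n) D i p * D i q = \sum_(i < n) D i (p * D i q).
  under [RHS]eq_bigr do rewrite mpoly.mderivM.
  by rewrite big_split /= -mulr_sumr [X in _ * X]lq mulr0 addr0.
have hi i : homog (a + b.-1) (p * D i q).
  by apply: mpoly.dhomogM => //; exact: mderiv_homog.
have -> : Sint (\sum_(i < n) D i (p * D i q)) =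
    \sum_(i < n) (a + b.-1 + n.-1)%:R * Sint (p * (mvar i * D i q)).
  rewrite Sint_sum; apply: eq_bigr.
  by move=> i _; rewrite (Sint_parts _ n0 (hi i)); congr (_ * Sint _); rewrite mulrCA.
rewrite -mulr_sumr -Sint_sum -mulr_sumr (euler hq) -scalerAr SintZ mulrA; congr (_ * _ * _).
by rewrite !natrD -(subn1 b) -(subn1 n) !natrB//; ring.
Qed.

(** The integral of [<grad p, grad q>] is symmetric in [p] and [q]. Subtracting its two evaluations
    leaves [(a + b + n - 2) (a - b)] times the integral of [p q], and the first factor is positive
    since [n > 2]. *)
Lemma Sint_orth a b p q : (2 < n)%N -> a != b -> hharm a p -> hharm b q -> Sint (p * q) = 0.
Proof.
move=> n2 ab hp hq; have n0 : (0 < n)%N by exact: leq_trans n2.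
have E2 := Sint_dot_mderiv n0 (proj1 hp) hq.
have E1 := Sint_dot_mderiv n0 (proj1 hq) hp.
rewrite (eq_bigr (fun i => D i p * D i q)) in E1; last by move=> i _; rewrite mulrC.
rewrite (mulrC q p) E2 in E1.
have : (a%:R + b%:R + n%:R - 2) * (a%:R - b%:R) * Sint (p * q) = 0.
  transitivity ((b%:R + a%:R + n%:R - 2) * a%:R * Sint (p * q) -
    (a%:R + b%:R + n%:R - 2) * b%:R * Sint (p * q)); first by ring.
  by rewrite E1 subrr.
move=> /eqP; rewrite !mulf_eq0 [a%:R - _ == 0]subr_eq0 eqr_nat (negbTE ab) orbF => /orP[|/eqP//].
have n3 : 2 < n%:R :> R by rewrite ltr_nat.
have a0 : 0 <= a%:R :> R by [].
have b0 : 0 <= b%:R :> R by [].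
by move=> /eqP; lra.
Qed.

Lemma Sint_hharm k p : (2 < n)%N -> (0 < k)%N -> hharm k p -> Sint p = 0.
Proof.
move=> n2 k0 hp; rewrite -[p]mul1r; apply: (Sint_orth n2 _ _ hp) => [|]; last first.
  split; first exact: mpoly.dhomog1.
  by rewrite /harmonic_poly /plap big1// => i _; rewrite -(mpoly.mpolyC1 n R) mpoly.mderivC raddf0.
by rewrite eq_sym -lt0n.
Qed.

(* The Laplace eigenvalue identity [Sint_dot_mderiv] trades [Sint (p ^ 2)] for the
   integrals of the squared derivatives, so positivity follows by induction on the
   degree from that of [Sint 1]. *)
Lemma Sint_sqr k p : (2 < n)%N -> hharm k p -> 0 <= Sint (p * p) /\ (Sint (p * p) = 0 -> p = 0).
Proof.
move=> n2; have n0 : (0 < n)%N by exact: leq_trans n2.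
elim: k p => [|k IH] p hp.
  have -> : p = mpoly.mcoeff mpoly.mnm0 p *: (1 : poly).
    rewrite -mpoly.mul_mpolyC mulr1.
    apply/mpoly.mpolyP => m; rewrite mpoly.mcoeffC; case: eqVneq => [->|m0]; first by rewrite mulr1.
    by rewrite mulr0 (mpoly.dhomog_nemf_coeff (proj1 hp))// mpoly.mdeg_eq0.
  set c := mpoly.mcoeff _ _; rewrite -scalerAl mul1r scalerA SintZ.
  have S1 := Sint1_gt0 R n0; split; first by rewrite pmulr_lge0// -expr2 sqr_ge0.
  by move/eqP; rewrite mulf_eq0 (gt_eqF S1) orbF -expr2 sqrf_eq0 => /eqP ->; rewrite scale0r.
have n3 : 2 < n%:R :> R by rewrite ltr_nat.
have k0 : 0 <= k%:R :> R by [].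
pose C : R := (k.+1%:R + k.+1%:R + n%:R - 2) * k.+1%:R.
have C0 : 0 < C by rewrite /C -natr1; nra.
have E : C * Sint (p * p) = \sum_(i < n) Sint (D i p * D i p).
  by rewrite -Sint_sum -(Sint_dot_mderiv n0 (proj1 hp) hp).
have hD i := IH _ (hharm_mderiv i hp).
have Dge0 : 0 <= \sum_(i < n) Sint (D i p * D i p) by apply: sumr_ge0 => i _; case: (hD i).
split; first by rewrite -(pmulr_rge0 _ C0) E.
move=> Sp0; move: E; rewrite Sp0 mulr0 => /esym/eqP.
rewrite psumr_eq0 => [/allP D0|i _]; last by case: (hD i).
have Dz i : D i p = 0.
  by case: (hD i) => _; apply; apply/eqP; exact: (D0 i (mem_index_enum i)).
have := euler (proj1 hp); rewrite big1 => [/esym/eqP|i _]; last by rewrite Dz mulr0.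
by rewrite scaler_eq0 pnatr_eq0 => /eqP.
Qed.

End SphericalHarmonics.

(** * The operator A *)

Section MainOperator.
Variables (R : realType) (n : nat).
Notation poly := (mpoly.mpoly n R).
Notation mvar := (@mvar R n).
Notation normsq := (@normsq R n).
Notation pdiv := (@Defs.pdiv R n).
Notation D := (@mpoly.mderiv n R).
Notation homog k p := (p \is @mpoly.ishomog1 n R k mpoly.mdeg).
Implicit Types (p q g : poly) (v w u : polymap R n) (x : 'I_n -> R).

Definition radial w : poly := \sum_(j < n) mvar j * w j.

Lemma meval_radial w x : mpoly.meval x (radial w) = dotp (evalw w x) x.
Proof.
rewrite /radial raddf_sum /=; apply: eq_bigr => j _.
by rewrite mpoly.mevalM mpoly.mevalXU mulrC.
Qed.

Lemma meval0_homog k p : (0 < k)%N -> homog k p -> mpoly.meval (fun _ => 0) p = 0.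
Proof.
case: k => // k _ hp; have := meval_homog 0 (fun _ => 0) hp.
by rewrite exprS !mul0r.
Qed.

Lemma dotp_pgrad k p x : homog k p -> dotp (pgrad p x) x = k%:R * mpoly.meval x p.
Proof.
move=> hp; rewrite -mpoly.mevalZ -(euler hp) raddf_sum; apply: eq_bigr => i _ /=.
by rewrite mpoly.mevalM mpoly.mevalXU mulrC.
Qed.

(** By Euler the radial components of the gradients are [k p] and [k q]. The factor [2 - |x|^2],
    equal to [1] on the sphere, keeps the identity valid everywhere, in particular at the origin,
    where [sphint_ext] needs it. *)
Lemma dotp_gradT k p q x : homog k p -> homog k q ->
  dotp (gradT p x) (gradT q x) = mpoly.meval x (\sum_(i < n) D i p * D i q)
    - k%:R ^+ 2 * (2 - dotp x x) * mpoly.meval x (p * q).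
Proof.
move=> hp hq; rewrite /gradT (dotp_pgrad x hp) (dotp_pgrad x hq) mpoly.mevalM.
have H (c d : R) : dotp (fun i => pgrad p x i - c * x i) (fun i => pgrad q x i - d * x i) =
    dotp (pgrad p x) (pgrad q x) - d * dotp (pgrad p x) x
    - c * dotp (pgrad q x) x + c * d * dotp x x.
  rewrite /dotp !mulr_sumr -!sumrB -big_split; apply: eq_bigr => i _ /=; ring.
rewrite H (dotp_pgrad x hp) (dotp_pgrad x hq).
have -> : mpoly.meval x (\sum_(i < n) D i p * D i q) = dotp (pgrad p x) (pgrad q x).
  by rewrite raddf_sum; apply: eq_bigr => i _ /=; rewrite mpoly.mevalM.
ring.
Qed.

(** Here [k (k + n - 2)] is the eigenvalue of minus the spherical Laplacian. The factor is positive
    for [n > 2], so for fields of degree [k] orthogonality in [W^{1,2}] amounts to orthogonality in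
    [L^2]. *)
Lemma w12E k v w : (0 < n)%N -> (0 < k)%N ->
  (forall j, hharm k (v j)) -> (forall j, hharm k (w j)) ->
  w12 v w = (1 + k%:R * (k%:R + n%:R - 2)) * \sum_(j < n) Sint (v j * w j).
Proof.
move=> n0 k0 hv hw; rewrite /w12.
have -> : sphint (fun x => dotp (evalw v x) (evalw w x)) = \sum_(j < n) Sint (v j * w j).
  rewrite -Sint_sum -sphint_meval; congr sphint; apply/funext => x.
  by rewrite raddf_sum; apply: eq_bigr => j _ /=; rewrite mpoly.mevalM.
pose T : poly := \sum_(j < n) (\sum_(i < n) D i (v j) * D i (w j) - k%:R ^+ 2 *: (v j * w j)).
rewrite (@sphint_ext _ _ _ (fun x => mpoly.meval x T)); first last.
- rewrite raddf_sum; apply: eq_bigr => j _ /=.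
  rewrite (dotp_gradT _ (proj1 (hv j)) (proj1 (hw j))) mpoly.mevalB mpoly.mevalZ mpoly.mevalM.
  by rewrite (meval0_homog k0 (proj1 (hv j))) !mul0r !mulr0.
- move=> x x1; rewrite raddf_sum; apply: eq_bigr => j _ /=.
  rewrite (dotp_gradT _ (proj1 (hv j)) (proj1 (hw j))) mpoly.mevalB mpoly.mevalZ x1.
  by congr (_ - _ * _); ring.
rewrite sphint_meval Sint_sum mulr_sumr -big_split; apply: eq_bigr => j _ /=.
rewrite SintB SintZ (Sint_dot_mderiv n0 (proj1 (hv j)) (hw j)); ring.
Qed.

Lemma mderiv_radial i w : D i (radial w) = w i + \sum_(j < n) mvar j * D i (w j).
Proof.
rewrite /radial raddf_sum /=.
under eq_bigr do rewrite mpoly.mderivM mderiv_mvar.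
rewrite big_split /= (bigD1 i)//= eqxx mul1r big1 ?addr0// => j ji.
by rewrite eq_sym (negbTE ji) mul0r.
Qed.

(** The normal corrections in [divS] and in the tangential gradients both contribute [k <w, x> x_i]
    and cancel. The remaining sum of [x_j D_i w_j] is [D_i <w, x> - w_i]. *)
Lemma AopE k w x i : (forall j, homog k (w j)) -> dotp x x = 1 ->
  Aop w x i = mpoly.meval x (pdiv w) * x i - mpoly.meval x (D i (radial w))
              + mpoly.meval x (w i).
Proof.
move=> hw x1; rewrite /Aop /divS /gradT.
have -> : \sum_(j < n) (pgrad (w j) x j - dotp (pgrad (w j) x) x * x j) =
    mpoly.meval x (pdiv w) - k%:R * mpoly.meval x (radial w).
  rewrite sumrB; congr (_ - _); first by rewrite raddf_sum.
  rewrite meval_radial /dotp mulr_sumr; apply: eq_bigr => j _.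
  by rewrite -/(dotp _ _) (dotp_pgrad x (hw j)) mulrA.
have -> : \sum_(j < n) x j * (pgrad (w j) x i - dotp (pgrad (w j) x) x * x i) =
    mpoly.meval x (\sum_(j < n) mvar j * D i (w j)) - k%:R * mpoly.meval x (radial w) * x i.
  rewrite raddf_sum meval_radial /dotp mulr_sumr mulr_suml -sumrB; apply: eq_bigr => j _ /=.
  rewrite mpoly.mevalM mpoly.mevalXU -/(dotp _ _) (dotp_pgrad x (hw j)) /evalw /pgrad; ring.
rewrite mderiv_radial mpoly.mevalD; ring.
Qed.

Lemma Sint_radial_pdiv k w : (0 < n)%N -> (forall j, homog k (w j)) ->
  (k + n.-1)%:R * Sint (radial w) = Sint (pdiv w).
Proof.
move=> n0 hw; rewrite /radial /pdiv !Sint_sum mulr_sumr; apply: eq_bigr => j _.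
by rewrite (Sint_parts j n0 (hw j)).
Qed.

(** Both mean conditions are automatic: the components are orthogonal to constants, and the mean of
    [<w, x>] is a multiple of the integral of the divergence. *)
Lemma in_Hsol_intro k w : (2 < n)%N -> (0 < k)%N -> (forall j, hharm k (w j)) ->
  pdiv w = 0 -> in_Hsol k w.
Proof.
move=> n2 k0 hw w0; have n0 : (0 < n)%N by exact: leq_trans n2.
split; last by move=> x _; rewrite w0 mpoly.meval0.
split => //; split => [j|].
  by rewrite /Av /evalw sphint_meval (Sint_hharm n2 k0 (hw j)) mul0r.
rewrite /Av; under eq_fun do rewrite -meval_radial.
have /eqP := Sint_radial_pdiv n0 (fun j => proj1 (hw j)).
rewrite w0 Sint0 mulf_eq0 pnatr_eq0 addn_eq0 (gtn_eqF k0) /= => /eqP.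
by rewrite sphint_meval => ->; rewrite mul0r.
Qed.

Lemma hharm_sum k (F : 'I_n -> poly) : (forall i, hharm k (F i)) -> hharm k (\sum_i F i).
Proof. by move=> hF; apply: (big_ind (hharm k)) => //; [exact: hharm0|exact: hharmD]. Qed.

Lemma hharm_pdiv k w : (forall j, hharm k (w j)) -> hharm k.-1 (pdiv w).
Proof. by move=> hw; apply: hharm_sum => i; exact: hharm_mderiv. Qed.

(** The integral of [p^2] over the sphere is zero, and [Sint_sqr] makes it definite. The value at
    the origin is required by [sphint_ext]. *)
Lemma hharm_eq0 k p : (2 < n)%N -> hharm k p ->
  (forall x, dotp x x = 1 -> mpoly.meval x p = 0) -> mpoly.meval (fun _ => 0) p = 0 -> p = 0.
Proof.
move=> n2 hp p1 p0; apply: (proj2 (Sint_sqr n2 hp)); rewrite -(@Sint0 R n) -!sphint_meval.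
apply: sphint_ext => [x /p1 px|]; by rewrite mpoly.mevalM mpoly.meval0 ?px ?p0 mul0r.
Qed.

(** The divergence is itself a homogeneous harmonic polynomial, and [in_ball] describes the closed
    ball, which contains both the sphere and the origin. *)
Lemma in_Hsol_pdiv k w : (2 < n)%N -> in_Hsol k w -> pdiv w = 0.
Proof.
move=> n2 [[hw _] w0]; apply: (hharm_eq0 n2 (hharm_pdiv hw)) => [x x1|]; apply: w0.
  by rewrite /in_ball x1.
by rewrite /in_ball /dotp big1 ?ler01// => i _; rewrite mul0r.
Qed.

Lemma plap_mvarM j p : plap (mvar j * p) = 2 *: D j p + mvar j * plap p.
Proof.
rewrite plapM; have -> : plap (mvar j) = 0.
  rewrite /plap big1// => i _; rewrite mderiv_mvar.
  by case: eqVneq => _; rewrite ?raddf0// -(mpoly.mpolyC1 n R) mpoly.mderivC.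
rewrite mul0r add0r; congr (_ *: _ + _).
rewrite (bigD1 j)//= mderiv_mvar eqxx mul1r big1 ?addr0// => i ij.
by rewrite mderiv_mvar (negbTE ij) mul0r.
Qed.

(** The Laplacian of [<w, x>] is [2 div w + <Delta w, x>]. *)
Lemma hharm_radial k w : (forall j, hharm k (w j)) -> pdiv w = 0 ->
  hharm k.+1 (radial w).
Proof.
move=> hw w0; split.
  rewrite rpred_sum// => j _; rewrite -add1n.
  by apply: mpoly.dhomogM; [exact: mvar_homog|case: (hw j)].
rewrite /harmonic_poly plap_sum; under eq_bigr => j _.
  rewrite plap_mvarM (proj2 (hw j)) mulr0 addr0.
  over.
by rewrite -scaler_sumr -/(pdiv w) w0 scaler0.
Qed.

Lemma pdivB v w : pdiv (fun j => v j - w j) = pdiv v - pdiv w.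
Proof. by rewrite /pdiv -sumrB; apply: eq_bigr => i _; rewrite raddfB. Qed.

Lemma pdivZ (c : R) w : pdiv (fun j => c *: w j) = c *: pdiv w.
Proof. by rewrite /pdiv scaler_sumr; apply: eq_bigr => i _; rewrite mpoly.mderivZ. Qed.

Lemma radialB v w : radial (fun j => v j - w j) = radial v - radial w.
Proof. by rewrite /radial -sumrB; apply: eq_bigr => i _; rewrite mulrBr. Qed.

Lemma radialZ (c : R) w : radial (fun j => c *: w j) = c *: radial w.
Proof. by rewrite /radial scaler_sumr; apply: eq_bigr => i _; rewrite scalerAr. Qed.

Lemma hharmB k p q : hharm k p -> hharm k q -> hharm k (p - q).
Proof. by move=> hp hq; rewrite -scaleN1r; apply: hharmD => //; exact: hharmZ. Qed.

(** * The eigenspaces inside the solenoidal fields *)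

Lemma Hsol_decomposition k w : (2 < n)%N -> (0 < k)%N -> in_Hsol k w ->
  exists w1 w2 : polymap R n, in_H1 k w1 /\ in_H2 k w2 /\
    forall j : 'I_n, w j = w1 j + w2 j.
Proof.
move=> n2 k0 hw; have w0 := in_Hsol_pdiv n2 hw; case: hw => -[hw _] _.
have hf := hharm_radial hw w0; set f := radial w in hf *.
have k1 : k.+1%:R != 0 :> R by rewrite pnatr_eq0.
pose w1 j := k.+1%:R^-1 *: D j f; pose w2 j := w j - w1 j.
have h1 j : hharm k (w1 j) by apply: hharmZ; exact: (hharm_mderiv j hf).
have h2 j : hharm k (w2 j) by exact: hharmB.
have d1 : pdiv w1 = 0 by rewrite pdivZ -[pdiv _]/(plap f) (proj2 hf) scaler0.
have d2 : pdiv w2 = 0 by rewrite pdivB w0 d1 subr0.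
(* By Euler [w1] carries the whole normal component of [w], so [w2] is tangential. *)
have r1 : radial w1 = f.
  by rewrite radialZ [radial _](euler (proj1 hf)) scalerA mulVf// scale1r.
have r2 : radial w2 = 0 by rewrite radialB r1 subrr.
exists w1, w2; split; [|split]; last by move=> j; rewrite /w2 addrC subrK.
  split; first exact: in_Hsol_intro.
  (* Since [D i f = (k + 1) w1 i], the formula for [A] gives [- (k + 1) w1 + w1 = - k w1]. *)
  move=> x x1 i; rewrite (AopE _ (fun j => proj1 (h1 j)) x1) d1 mpoly.meval0 r1 mul0r sub0r.
  rewrite /evalw /w1 mpoly.mevalZ -natr1; field.
  by rewrite natr1.
split; first exact: in_Hsol_intro.
move=> x x1 i; rewrite (AopE _ (fun j => proj1 (h2 j)) x1) d2 r2 !raddf0.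
by rewrite mul0r !add0r mul1r.
Qed.

(** The eigenvalues [- k] and [1] differ, so [w] vanishes on the sphere, and [hharm_eq0] makes its
    components zero as polynomials. *)
Lemma Hsol_eigenspaces_disjoint k w : (2 < n)%N -> (0 < k)%N -> in_H1 k w -> in_H2 k w ->
  forall j, w j = 0.
Proof.
move=> n2 k0 [[[hw _] _] A1] [_ A2] j.
apply: (hharm_eq0 n2 (hw j)); last exact: meval0_homog (proj1 (hw j)).
move=> x x1; have := A2 x x1 j; rewrite (A1 x x1 j) /evalw mul1r => /eqP.
rewrite -subr_eq0 -{2}(mul1r (mpoly.meval _ _)) -mulrBl mulf_eq0 => /orP[|/eqP//].
rewrite -opprD oppr_eq0 natr1 pnatr_eq0//.
Qed.

(** * The orthogonal complement of the solenoidal fields *)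

Lemma normsq_homog : homog 2 normsq.
Proof. by rewrite rpred_sum// => j _; apply: (mpoly.dhomogMn 2 (mvar_homog R j)). Qed.

Lemma plap_normsqM k p : hharm k p -> plap (normsq * p) = (2 * n%:R + 4 * k%:R) *: p.
Proof.
move=> [hp lp]; rewrite plapM (lp : plap p = 0) mulr0 addr0.
have -> : plap normsq = (2 * n%:R) *: (1 : poly).
  rewrite /plap; under eq_bigr do rewrite mderiv_normsq mpoly.mderivZ mderiv_mvar eqxx.
  by rewrite sumr_const card_ord -scaler_nat scalerA mulrC.
under eq_bigr do rewrite mderiv_normsq -scalerAl.
rewrite -scaler_sumr (euler hp) !scalerA -scalerAl mul1r -scalerDl.
by congr (_ *: _); ring.
Qed.

(* The harmonic projection of [x g]; the adjoint of the divergence, up to a factor. *)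
Definition xharm (c : R) g : polymap R n := fun j => mvar j * g - c *: (normsq * D j g).

Lemma pdiv_xharm k (c : R) g : hharm k g ->
  pdiv (xharm c g) = (n%:R + k%:R - 2 * c * k%:R) *: g.
Proof.
move=> [hg lg]; rewrite /pdiv /xharm.
under eq_bigr => j _.
  rewrite mpoly.mderivB mpoly.mderivZ !mpoly.mderivM mderiv_mvar eqxx mul1r mderiv_normsq -scalerAl.
  over.
rewrite sumrB !big_split /= sumr_const card_ord (euler hg) -scaler_sumr big_split /=.
rewrite -scaler_sumr (euler hg) -mulr_sumr [X in normsq * X]lg mulr0 addr0 -scaler_nat !scalerA.
rewrite -scalerDl -scalerBl; congr (_ *: _); ring.
Qed.

Lemma radial_xharm k (c : R) g : hharm k g ->
  radial (xharm c g) = (1 - c * k%:R) *: (normsq * g).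
Proof.
move=> [hg lg]; rewrite /radial /xharm.
transitivity (\sum_(j < n) (mvar j ^+ 2 * g - c *: (normsq * (mvar j * D j g)))).
  apply: eq_bigr => j _; rewrite mulrBr expr2 -scalerAr; congr (_ - _ *: _).
    by rewrite mulrA.
  by rewrite mulrCA.
rewrite sumrB -mulr_suml -scaler_sumr -mulr_sumr (euler hg) -scalerAr scalerA.
by rewrite scalerBl scale1r.
Qed.

(** The Laplacians of [x_j g] and [|x|^2 D_j g] are [2 D_j g] and [(2 n + 4 (k - 1)) D_j g], and the
    condition on [c] makes them cancel. Here [k] is the degree of [g], one less than that of the
    field. *)
Lemma hharm_xharm k (c : R) g j : c * (n%:R + 2 * k%:R - 2) = 1 -> hharm k g ->
  hharm k.+1 (xharm c g j).
Proof.
move=> hc hg; have [k0|k0] := posnP k.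
  have Dg : D j g = 0 by apply: mderiv_homog0; case: hg; rewrite k0.
  rewrite /xharm Dg mulr0 scaler0 subr0; split.
    by rewrite -add1n; apply: mpoly.dhomogM; [exact: mvar_homog|case: hg].
  by rewrite /harmonic_poly plap_mvarM Dg (proj2 hg) mulr0 scaler0 addr0.
have hD := hharm_mderiv j hg; split.
  rewrite rpredB//.
    by rewrite -add1n; apply: mpoly.dhomogM; [exact: mvar_homog|case: hg].
  apply: mpoly.dhomogZ; rewrite -(prednK k0) -addn2 addnC.
  by apply: mpoly.dhomogM; [exact: normsq_homog|case: hD].
rewrite /harmonic_poly /xharm -scaleN1r plapD !plapZ plap_mvarM (proj2 hg) mulr0 addr0.
rewrite (plap_normsqM hD) !scalerA -scalerDl (_ : _ + _ = 0) ?scale0r//.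
have -> : k.-1%:R = k%:R - 1 :> R by rewrite -subn1 natrB.
have -> : 2 + -1 * c * (2 * n%:R + 4 * (k%:R - 1)) = 2 - 2 * (c * (n%:R + 2 * k%:R - 2)) by ring.
by rewrite hc; ring.
Qed.

(** The factor [|x|^2] is [1] on the sphere; positive degree makes both integrands vanish at the
    origin, as [sphint_ext] demands. *)
Lemma Sint_normsqM k p : (0 < k)%N -> homog k p -> Sint (normsq * p) = Sint p.
Proof.
move=> k0 hp; rewrite -!sphint_meval; apply: sphint_ext => [x x1|].
  rewrite mpoly.mevalM (_ : mpoly.meval x normsq = 1) ?mul1r// -x1.
  rewrite /normsq raddf_sum; apply: eq_bigr => j _ /=.
  by rewrite expr2 mpoly.mevalM mpoly.mevalXU.
by rewrite mpoly.mevalM (meval0_homog k0 hp) mulr0.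
Qed.

(** On the sphere the product is [g <u, x> - c <grad g, u>]. The first term integrates to zero
    because its factors are harmonic of degrees [k] and [k + 2]. The second contains
    [<grad g, u> = div (g u)], which integration by parts reduces to the first. *)
Lemma Sint_xharm_sol k (c : R) g u : (2 < n)%N -> hharm k g ->
  (forall j, hharm k.+1 (u j)) -> pdiv u = 0 ->
  \sum_(j < n) Sint (xharm c g j * u j) = 0.
Proof.
move=> n2 hg hu u0; have n0 : (0 < n)%N by exact: leq_trans n2.
have G : Sint (g * radial u) = 0.
  by apply: (Sint_orth n2 _ hg (hharm_radial hu u0)); rewrite -addn2 -{1}(addn0 k) eqn_add2l.
pose h := \sum_(j < n) D j g * u j.
have hh : homog (k.-1 + k.+1) h.
  rewrite rpred_sum// => j _; apply: mpoly.dhomogM; last by case: (hu j).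
  exact: mderiv_homog (proj1 hg).
have Sh : Sint h = 0.
  have -> : h = \sum_(j < n) D j (g * u j).
    under [RHS]eq_bigr do rewrite mpoly.mderivM.
    by rewrite big_split /= -mulr_sumr -/(pdiv u) u0 mulr0 addr0.
  have hgu j : homog (k + k.+1) (g * u j).
    exact: mpoly.dhomogM (proj1 hg) (proj1 (hu j)).
  rewrite Sint_sum (eq_bigr (fun j => (k + k.+1 + n.-1)%:R * Sint (g * (mvar j * u j)))).
    by rewrite -mulr_sumr -Sint_sum -mulr_sumr G mulr0.
  by move=> j _; rewrite (Sint_parts j n0 (hgu j)); congr (_ * Sint _); rewrite mulrCA.
rewrite -Sint_sum.
have -> : \sum_(j < n) xharm c g j * u j = g * radial u - c *: (normsq * h).
  rewrite /radial /h !mulr_sumr scaler_sumr -sumrB; apply: eq_bigr => j _.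
  by rewrite /xharm mulrBl -scalerAl -mulrA mulrCA -(mulrA normsq) mulrA.
rewrite SintB SintZ (Sint_normsqM _ hh) ?addnS// G Sh; ring.
Qed.

Lemma Hsol_perp_eigen k w : (2 < n)%N -> (0 < k)%N -> in_Hsol_perp k w ->
  A_eig (k + n - 2)%:R w.
Proof.
(* From here [k] is the degree of the divergence [g], and [w] has degree [k + 1]. *)
case: k => // k n2 _ [[hw _] wperp]; have n0 : (0 < n)%N by exact: leq_trans n2.
have n3 : 3 <= n%:R :> R by rewrite ler_nat.
have k0 : 0 <= k%:R :> R by [].
pose g := pdiv w; have hg : hharm k g := hharm_pdiv hw.
pose e : R := n%:R + 2 * k%:R - 2; have e0 : e != 0 by rewrite /e; apply/eqP; lra.
pose c := e^-1; have ce : c * e = 1 by rewrite mulVf.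
pose a : R := n%:R + k%:R - 2 * c * k%:R.
have ae : a * e = (n%:R + k%:R) * e - 2 * k%:R.
  by rewrite /a mulrBl; congr (_ - _); rewrite -[RHS]mulr1 -ce; ring.
(* With [n >= 3] one has [e >= 2 k + 1], so [a e = (n + k) e - 2 k] is positive. *)
have a0 : a != 0.
  apply/eqP => a0; move: ae; rewrite a0 mul0r /e; nra.
pose v := xharm c g; have hv j : hharm k.+1 (v j) by exact: hharm_xharm.
pose u j := w j - a^-1 *: v j.
have hu j : hharm k.+1 (u j) by apply: hharmB => //; exact: hharmZ.
have u0 : pdiv u = 0.
  by rewrite pdivB pdivZ (pdiv_xharm c hg) scalerA mulVf// scale1r subrr.
have nk : 0 < 1 + k.+1%:R * (k.+1%:R + n%:R - 2) :> R by rewrite -natr1; nra.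
have wu : \sum_(j < n) Sint (w j * u j) = 0.
  have /eqP := wperp u (in_Hsol_intro n2 (ltn0Sn k) hu u0).
  by rewrite (w12E n0 (ltn0Sn k) hw hu) mulf_eq0 (gt_eqF nk) => /eqP.
(* The solenoidal [u = w - v / a] is orthogonal to [w] by hypothesis and to [v] by [Sint_xharm_sol],
   hence to itself. *)
have uu : \sum_(j < n) Sint (u j * u j) = 0.
  transitivity (\sum_(j < n) Sint (w j * u j) - a^-1 * \sum_(j < n) Sint (v j * u j)).
    rewrite mulr_sumr -sumrB; apply: eq_bigr => j _.
    by rewrite -SintZ -SintB {1}/u mulrBl scalerAl.
  by rewrite wu (Sint_xharm_sol c n2 hg hu u0) mulr0 subr0.
have uz j : u j = 0.
  have [_] := Sint_sqr n2 (hu j); apply.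
  move/eqP: uu; rewrite psumr_eq0 => [/allP/(_ j (mem_index_enum j))/eqP//|i _].
  by case: (Sint_sqr n2 (hu i)).
have wv j : w j = a^-1 *: v j by apply/eqP; rewrite -subr_eq0; exact/eqP/uz.
have rw : radial w = (a^-1 * (1 - c * k%:R)) *: (normsq * g).
  by rewrite -scalerA -(radial_xharm c hg) -radialZ; apply: eq_bigr => j _; rewrite wv.
move=> x x1 i; rewrite (AopE _ (fun j => proj1 (hw j)) x1) -/g rw /evalw wv.
have q1 : mpoly.meval x normsq = 1.
  rewrite -x1 /normsq raddf_sum; apply: eq_bigr => j _ /=.
  by rewrite expr2 mpoly.mevalM mpoly.mevalXU.
rewrite mpoly.mderivZ mpoly.mderivM mderiv_normsq /v /xharm.
rewrite !(mpoly.mevalZ, mpoly.mevalD, mpoly.mevalN, mpoly.mevalM, mpoly.mevalXU) q1.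
set X := mpoly.meval x g; set Y := mpoly.meval x (D i g).
have -> : (k.+1 + n - 2)%:R = k%:R + n%:R - 1 :> R.
  by rewrite natrB ?natrD -?natr1; [ring|rewrite addSn ltnS (leq_trans _ (leq_addl k n))// ltnW].
(* The eigenvalue equation on the sphere for [v], whose divergence is [a g] and whose normal
   component is [(1 - c k) |x|^2 g]. The two sides differ by [(c e - 1) Y], which is zero by the
   choice of [c]. *)
have key : a * (X * x i) - (1 - c * k%:R) * (2 * x i * X + Y) + (x i * X - c * Y) =
    (k%:R + n%:R - 1) * (x i * X - c * Y).
  transitivity ((k%:R + n%:R - 1) * (x i * X - c * Y) + (c * e - 1) * Y).
    rewrite /a /e; ring.
  rewrite ce; ring.
rewrite !mul1r [RHS]mulrCA -key; field.
exact: a0.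
Qed.

End MainOperator.

Theorem theorem4p7 (R : realType) (n k : nat) :
  (3 <= n)%N -> (1 <= k)%N ->
  (* (i) H_{n,k,sol} = H_{n,k,1} (+) H_{n,k,2} *)
  ((forall w : polymap R n, in_Hsol k w ->
      exists w1 w2 : polymap R n, in_H1 k w1 /\ in_H2 k w2 /\
        forall j : 'I_n, w j = w1 j + w2 j) /\
   (forall w : polymap R n, in_H1 k w -> in_H2 k w -> forall j : 'I_n, w j = 0)) /\
  (* (ii) A = (k+n-2) Id on H_{n,k,sol}^perp *)
  (forall w : polymap R n, in_Hsol_perp k w -> A_eig (k + n - 2)%:R w).
Proof.
move=> n2 k0; split; first split.
- by move=> w hw; exact: Hsol_decomposition.
- by move=> w h1 h2; exact: Hsol_eigenspaces_disjoint h1 h2.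
- by move=> w; exact: Hsol_perp_eigen.
Qed.
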